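(* Assume the location-scale assumption holds and the losses $\ell(z,\eta)$ have lighter-than-Gaussian tails. Suppose the class of Gaussian mixture models $\{\mathbb{Q}^\theta\}_{\theta\in\Theta}$, $\theta=(\pi,\mu,\sigma)$, satisfies: 1. there exists $B>0$ such that $\max_{j}\sigma_j\le B$ and $\max_j|\mu_j|\le B$ for all $(\pi,\mu,\sigma)\in\Theta$; 2. there exist $\epsilon>0$, $B'>-\infty$ and some component index $j\in\{1,\dots,J\}$ such that $\pi_j\ge\epsilon$, $\mu_j\ge B'$ and $\sigma_j\ge\epsilon$ for all $(\pi,\mu,\sigma)\in\Theta$. Let $\mathbb{Q}_N$ be obtained from the affine-equivariant mean-preserving calibration algorithm. Then $\rho_{\hat{\mathbb{P}}_N}(\ell(z,\eta))+\delta_N(\mathbb{Q}_N)$ is an asymptotically consistent estimator of $\rho_{\mathbb{P}}(\ell(z,\eta))$ as $N\to\infty$, and $$\mathbb{E}\big[\rho_{\hat{\mathbb{P}}_N}(\ell(z,\eta))+\delta_N(\mathbb{Q}_N)\big]-\rho_{\mathbb{P}}(\ell(z,\eta))=\Omega\big(\mathrm{Var}(\ell(z,\eta))\big),$$ $$\Big|\rho_{\mathbb{P}}(\ell(z,\eta))-\mathbb{E}\big[\rho_{\hat{\mathbb{P}}_N}(\ell(z,\eta))+\delta_N(\mathbb{Q}_N)\big]\Big|=\mathcal{O}\big(\mathrm{Var}(\ell(z,\eta))\big).$$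
   Context: Fix $\alpha>0$. $\mathcal{Z}\subseteq\mathbb{R}^d$ is a set of decisions, $\eta$ is a random vector with law $\mathbb{P}$, and $\ell(z,\eta)$ is a real random loss for each $z\in\mathcal{Z}$. For a distribution $\mathbb{Q}$, $\rho_{\mathbb{Q}}(X)=\frac1\alpha\log\mathbb{E}_{\mathbb{Q}}[\exp(\alpha X)]\in(-\infty,\infty]$ is the entropic risk. $\hat{\mathbb{P}}_N$ is the empirical distribution of i.i.d. samples $\hat\eta_1,\dots,\hat\eta_N$ from $\mathbb{P}$; $\mathbb{E}$ in the claim is over the samples. Location-scale assumption: there are a fixed real random variable $\xi$ with $\mathbb{E}[\xi]=0$, $\mathbb{E}[\xi^2]=1$ and a set $\mathcal{A}\subset\mathbb{R}\times\mathbb{R}_+$ such that the set of distributions of $\{\ell(z,\eta):z\in\mathcal{Z}\}$ equals the set of distributions of $\{\mu+\sigma\xi:(\mu,\sigma)\in\mathcal{A}\}$. $X$ has lighter-than-Gaussian tails if there are $q>2$ and $G,C>0$ with $\mathbb{P}(|X|\ge a)\le G\exp(-Ca^q)$ for all $a\ge0$. Gaussian mixture model: for a fixed number $J$ of components and $\theta=(\pi,\mu,\sigma)$ with weights $\pi\in\mathbb{R}^J$ ($\pi_j\ge0$, $\sum_j\pi_j=1$), means $\mu\in\mathbb{R}^J$ and standard deviations $\sigma\in\mathbb{R}_+^J$, $\mathbb{Q}^\theta=\sum_j\pi_j\mathcal{N}(\mu_j,\sigma_j^2)$ (a component with $\sigma_j=0$ being a Dirac mass). $\Theta$ is a fixed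 parameter set. Calibration algorithm, applied to the scenarios $\zeta_i=\ell(z,\hat\eta_i)$, $i=1,\dots,N$: let $\hat\mu_N=\frac1N\sum_i\zeta_i$, $\hat\sigma_N=\sqrt{\frac1N\sum_i(\zeta_i-\hat\mu_N)^2}$; form the standardized sample $\zeta_i'=(\zeta_i-\hat\mu_N)/\hat\sigma_N$; let $\bar\Theta=\{\theta\in\Theta:\mathbb{E}_{\mathbb{Q}^\theta}[\xi']=0\}$, where $\xi'\sim\mathbb{Q}^\theta$ (assumed nonempty); fit a parameter $\theta^*\in\bar\Theta$ to the standardized sample (any rule depending on the data only through the standardized sample); output $\mathbb{Q}_N$, the distribution of $\hat\mu_N+\hat\sigma_N\xi'$ with $\xi'\sim\mathbb{Q}^{\theta^*}$. It is implicit that $\hat\sigma_N>0$ almost surely so that the algorithm is well defined. Given $\mathbb{Q}_N$, let $\zeta\sim\mathbb{Q}_N$ and let $\hat{\mathbb{Q}}_{N,N}$ be the empirical distribution of $N$ i.i.d. draws from $\mathbb{Q}_N$; $\delta_N(\mathbb{Q}_N):=\mathrm{median}(\rho_{\mathbb{Q}_N}(\zeta)-\rho_{\hat{\mathbb{Q}}_{N,N}}(\zeta)\,|\,\mathbb{Q}_N)$, the median being over the draws producing $\hat{\mathbb{Q}}_{N,N}$. Asymptotically consistent means converging in probability to the target as $N\to\infty$, for a fixed decision $z$. Asymptotic notation: $\alpha$, $N$, the fitting rule and the law of $\xi$ are fixed, and quantities are considered as $\sigma=\sqrt{\mathrm{Var}(\ell(z,\eta))}$ varies. $f=\mathcal{O}(g(\sigma))$: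 there are $c,\bar\sigma>0$ with $f\le c\,g(\sigma)$ whenever $\sigma\ge\bar\sigma$. $f=\Omega(g(\sigma))$: there are $c,\bar\sigma>0$ with $c\,g(\sigma)\le f$ whenever $\sigma\ge\bar\sigma$. *)

(* Defs.v *)
From HB Require Import structures.
From mathcomp Require Export all_boot all_order all_algebra.
From mathcomp Require Export all_classical all_reals all_analysis measurable_realfun.
Export Order.TTheory GRing.Theory Num.Theory.
Export numFieldNormedType.Exports.

Set Implicit Arguments.
Unset Strict Implicit.
Unset Printing Implicit Defensive.

Local Open Scope classical_set_scope.
Local Open Scope ring_scope.
Local Open Scope ereal_scope.

Definition entropic_risk (d : measure_display) (T : measurableType d)
    (R : realType) (alpha : R) (Q : set T -> \bar R) (X : T -> R) : \bar R :=
  (alpha^-1)%:E * lne (\int[Q]_t (expR (alpha * X t))%:E).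

Definition empirical (d : measure_display) (T : measurableType d)
    (R : realType) (N : nat) (x : nat -> T) : {measure set T -> \bar R} :=
  mscale ((N%:R^-1)%:nng)%R (msum (fun i => \d_(x i)) N).

Definition same_law (d : measure_display) (T : measurableType d)
    (R : realType) (mu nu : set T -> \bar R) : Prop :=
  forall B, measurable B -> mu B = nu B.

Definition mutually_independent (d d' : measure_display)
    (T : measurableType d) (T' : measurableType d') (R : realType)
    (P : probability T R) (X : nat -> T -> T') : Prop :=
  forall (s : seq nat) (B : nat -> set T'), uniq s ->
    (forall i, measurable (B i)) ->
    P (\bigcap_(i in [set` s]) (X i @^-1` B i)) =
    \prod_(i <- s) P (X i @^-1` B i).

Definition cvg_in_probability (d : measure_display) (T : measurableType d)
    (R : realType) (P : probability T R) (X : nat -> T -> \bar R)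
    (c : \bar R) : Prop :=
  forall eps : R, (0 < eps)%R ->
    P [set w | eps%:E <= `|X N w - c|] @[N --> \oo] --> 0.

(* The lower median.  All medians coincide for the laws to which it is applied
   below, as soon as one mixture component is nondegenerate. *)
Definition median (d : measure_display) (T : measurableType d)
    (R : realType) (P : probability T R) (X : T -> \bar R) : \bar R :=
  ereal_inf [set m : \bar R | (2^-1)%:E <= P [set t | X t <= m]].

Section iid_draws.
Variable R : realType.

Definition tuple_cons (n : nat) (p : R * n.-tuple R) : n.+1.-tuple R :=
  [tuple of p.1 :: p.2].

Lemma measurable_tuple_cons n : measurable_fun setT (@tuple_cons n).
Proof. exact: (measurable_cons measurable_fst measurable_snd). Qed.

HB.instance Definition _ n := isMeasurableFun.Build _ _ _ _
  (@tuple_cons n) (@measurable_tuple_cons n).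

(* the n-fold product measure, i.e. the joint law of n i.i.d. draws from Q *)
Fixpoint iid_law (Q : probability R R) (n : nat) :
    probability (n.-tuple R) R :=
  match n with
  | 0 => dirac [tuple]
  | m.+1 => distribution (Q \x iid_law Q m) (@tuple_cons m)
  end.

End iid_draws.

Section gaussian.
Variables (R : realType) (m s : R).

(* [normal_prob m 0] is a uniform law in the library, hence the case split. *)
Definition gauss (A : set R) : \bar R :=
  if s == 0%R then \d_m A else normal_prob m s A.

Let gauss0 : gauss set0 = 0.
Proof.
rewrite /gauss; case: ifP => _; first exact: measure0.
exact: (@measure0 _ _ _ (normal_prob m s)).
Qed.

Let gauss_ge0 A : 0 <= gauss A.
Proof.
rewrite /gauss; case: ifP => _; first exact: measure_ge0.
exact: (@measure_ge0 _ _ _ (normal_prob m s)).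
Qed.

Let gauss_semi_sigma_additive : semi_sigma_additive gauss.
Proof.
rewrite /gauss; case: (s == 0%R); first exact: measure_semi_sigma_additive.
exact: (@measure_semi_sigma_additive _ _ _ (normal_prob m s)).
Qed.

HB.instance Definition _ := isMeasure.Build _ _ _ gauss
  gauss0 gauss_ge0 gauss_semi_sigma_additive.

Let gauss_setT : gauss setT = 1.
Proof.
rewrite /gauss; case: ifP => _; first exact: (@probability_setT _ _ _ (dirac m)).
exact: (@probability_setT _ _ _ (normal_prob m s)).
Qed.

HB.instance Definition _ := Measure_isProbability.Build _ _ _ gauss gauss_setT.

End gaussian.

Section gaussian_mixture.
Variables (R : realType) (J : nat).

Record gmm_param := GmmParam {
  weights : J.-tuple R ;
  means : J.-tuple R ;
  sdevs : J.-tuple R ;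
  weights_ge0 : forall j, (0 <= tnth weights j)%R ;
  weights_sum1 : (\sum_j tnth weights j = 1)%R ;
  sdevs_ge0 : forall j, (0 <= tnth sdevs j)%R }.

Variable theta : gmm_param.

Definition gmm (A : set R) : \bar R :=
  \sum_(j < J) (tnth (weights theta) j)%:E *
    gauss (tnth (means theta) j) (tnth (sdevs theta) j) A.

Let gmm0 : gmm set0 = 0.
Proof. by rewrite /gmm big1// => j _; rewrite measure0 mule0. Qed.

Let gmm_ge0 A : 0 <= gmm A.
Proof.
by apply: sume_ge0 => j _; rewrite mule_ge0 ?lee_fin ?weights_ge0.
Qed.

Let gmm_semi_sigma_additive : semi_sigma_additive gmm.
Proof.
pose w (j : 'I_J) : {nonneg R} := NngNum (weights_ge0 theta j).
pose m (j : 'I_J) : {measure set R -> \bar R} :=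
  mscale (w j) (gauss (tnth (means theta) j) (tnth (sdevs theta) j)).
have -> : gmm = fun A => \sum_(j < J) m j A by [].
case: J m => [|n] m.
  rewrite (_ : (fun A => _) = mzero); last first.
    by apply/funext => A; rewrite big_ord0.
  exact: measure_semi_sigma_additive.
rewrite (_ : (fun A => _) = msum (fun k => m (inord k)) n.+1).
  exact: measure_semi_sigma_additive.
by apply/funext => A; apply: eq_bigr => j _; rewrite inord_val.
Qed.

HB.instance Definition _ := isMeasure.Build _ _ _ gmm
  gmm0 gmm_ge0 gmm_semi_sigma_additive.

Let gmm_setT : gmm setT = 1.
Proof.
rewrite /gmm (eq_bigr (fun j => (tnth (weights theta) j)%:E)).
  by rewrite sumEFin weights_sum1.
by move=> j _; rewrite probability_setT mule1.
Qed.

HB.instance Definition _ := Measure_isProbability.Build _ _ _ gmm gmm_setT.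

End gaussian_mixture.

Definition centered (R : realType) (J : nat) (Theta : set (gmm_param R J)) :
    set (gmm_param R J) :=
  [set theta | Theta theta /\ 'E_(gmm theta)[idfun] = 0].

Definition affine (R : realType) (m s : R) (x : R) : R := (m + s * x)%R.

Lemma measurable_affine (R : realType) (m s : R) :
  measurable_fun setT (affine m s).
Proof. by apply: measurable_funD => //; exact: measurable_funM. Qed.

HB.instance Definition _ (R : realType) (m s : R) :=
  isMeasurableFun.Build _ _ _ _ (affine m s) (measurable_affine m s).

Section calibration.
Variables (R : realType) (J : nat).
Local Open Scope ring_scope.

Definition smean (N : nat) (x : N.-tuple R) : R := N%:R^-1 * \sum_i tnth x i.

Definition ssdev (N : nat) (x : N.-tuple R) : R :=
  Num.sqrt (N%:R^-1 * \sum_i (tnth x i - smean x) ^+ 2).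

Definition standardize (N : nat) (x : N.-tuple R) : N.-tuple R :=
  [tuple (tnth x i - smean x) / ssdev x | i < N].

(* The rule is only ever applied to standardized samples (see [calibrate]), so
   its values elsewhere are irrelevant; measurability is what makes the
   expectation over the samples meaningful. *)
Definition fitting_rule (Theta : set (gmm_param R J))
    (fit : forall N, N.-tuple R -> gmm_param R J) : Prop :=
  forall N, [/\ forall x : N.-tuple R, centered Theta (fit N x),
    measurable_fun setT (fun x : N.-tuple R => weights (fit N x)),
    measurable_fun setT (fun x : N.-tuple R => means (fit N x)) &
    measurable_fun setT (fun x : N.-tuple R => sdevs (fit N x))].

Definition calibrate (fit : forall N, N.-tuple R -> gmm_param R J)
    (N : nat) (x : N.-tuple R) : probability R R :=
  distribution (gmm (fit N (standardize x))) (affine (smean x) (ssdev x)).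

End calibration.

(* Conditionally on Q, the median over N i.i.d. draws of the gap between the
   risk under Q and the risk under the empirical law of the draws. *)
Definition bias_correction (R : realType) (alpha : R) (N : nat)
    (Q : probability R R) : \bar R :=
  median (iid_law Q N) (fun x : N.-tuple R =>
    entropic_risk alpha Q idfun -
    entropic_risk alpha (empirical R N (nth 0%R x)) idfun).

(* The random vector driving the loss enters through its law only; [sample] is
   the i.i.d. data, living on its own probability space. *)
Record model (R : realType) := Model {
  zdim : nat ;
  decisions : set 'rV[R]_zdim ;
  edim : nat ;
  law : probability (edim.-tuple R) R ;
  loss : 'rV[R]_zdim -> edim.-tuple R -> R ;
  loss_measurable : forall z, decisions z -> measurable_fun setT (loss z) ;
  disp : measure_display ;
  Omega : measurableType disp ;
  Pr : probability Omega R ;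
  sample : nat -> Omega -> edim.-tuple R ;
  sample_measurable : forall i, measurable_fun setT (sample i) ;
  sample_law : forall i, same_law (pushforward Pr (sample i)) law ;
  sample_independent : mutually_independent Pr sample }.

Arguments decisions {R} M _ : rename.
Arguments law {R} M : rename.
Arguments loss {R} M _ _ : rename.
Arguments Pr {R} M : rename.
Arguments sample {R} M _ _ : rename.

Section model_theory.
Variables (R : realType) (alpha : R) (M : model R).

Definition lighter_than_gaussian (d : measure_display) (T : measurableType d)
    (P : probability T R) (X : T -> R) : Prop :=
  exists q G C : R, [/\ (2 < q)%R, (0 < G)%R, (0 < C)%R &
    forall a : R, (0 <= a)%R ->
      P [set t | (a <= `|X t|)%R] <= (G * expR (- C * a `^ q))%:E].

Definition light_tailed_losses : Prop :=
  forall z, decisions M z -> lighter_than_gaussian (law M) (loss M z).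

(* Equality of the two sets of distributions, as mutual inclusion up to
   [same_law]: values on nonmeasurable sets carry no meaning. *)
Definition location_scale (d : measure_display) (T : measurableType d)
    (P : probability T R) (xi : {RV P >-> R}) : Prop :=
  exists A : set (R * R), [/\
    forall p, A p -> (0 <= p.2)%R,
    forall z, decisions M z -> exists2 p, A p &
      same_law (pushforward (law M) (loss M z))
               (distribution P (affine p.1 p.2 \o xi)) &
    forall p, A p -> exists2 z, decisions M z &
      same_law (pushforward (law M) (loss M z))
               (distribution P (affine p.1 p.2 \o xi))].

Variable z : 'rV[R]_(zdim M).

Definition true_risk : \bar R := entropic_risk alpha (law M) (loss M z).

Definition loss_variance : \bar R := 'V_(law M)[loss M z].

(* extended-real square root of the variance *)
Definition loss_sdev : \bar R := loss_variance `^ (2^-1).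

Definition scenarios (N : nat) (w : Omega M) : N.-tuple R :=
  [tuple loss M z (sample M i w) | i < N].

(* Standardization divides by a nonzero number; this excludes N <= 1. *)
Definition well_defined (N : nat) : Prop :=
  {ae Pr M, forall w, (0 < ssdev (scenarios N w))%R}.

Variables (J : nat) (fit : forall N, N.-tuple R -> gmm_param R J).

Definition estimator (N : nat) (w : Omega M) : \bar R :=
  entropic_risk alpha (empirical R N (fun i => sample M i w)) (loss M z) +
  bias_correction alpha N (calibrate fit (scenarios N w)).

Definition mean_estimator (N : nat) : \bar R :=
  \int[Pr M]_w estimator N w.

End model_theory.

(* Main.v *)
From HB Require Import structures.
From mathcomp Require Import ring lra.
Require Import Defs.

Set Implicit Arguments.
Unset Strict Implicit.
Unset Printing Implicit Defensive.

Local Open Scope classical_set_scope.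
Local Open Scope ring_scope.
Local Open Scope ereal_scope.

(** Write s for the standard deviation of the N scenarios. The proof rests on
    the fact that, whatever the fitting rule does, the bias correction is of
    order s ^ 2 from above and from below, up to additive constants.

    The calibrated law is that of m + s * x, with m the mean of the scenarios
    and x drawn from a mixture whose parameters are bounded and one of whose
    components has weight and standard deviation at least eps. The moment
    generating function of such a mixture at t lies between
    eps * exp (t b + (t eps) ^ 2 / 2) and exp (|t| B + (t B) ^ 2 / 2), so the
    risk of the calibrated law exceeds m by an amount of order s ^ 2. In
    contrast, N draws from that law stay, with probability above 1/2, within
    a constant times s + 1 of m, hence so does the risk of their empirical law.
    The median of the difference is therefore caught between two quadratic
    functions of s ([bias_correction_ge], [bias_correction_le]).

    The risk of the empirical law of the scenarios lies between their mean and
    their mean plus N s ^ 2 + 1. Since the expectation of s ^ 2 is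
    (1 - 1/N) Var ([mean_ssdev_sqr]), the expected estimator exceeds the mean
    loss by an amount that is caught between two affine functions of the
    variance ([mean_estimator_ge], [mean_estimator_le]).

    The true risk is at least the mean loss, by Jensen's inequality, and exceeds
    it by only o(Var): the tails being lighter than Gaussian, exp (k xi ^ 2) has
    a finite expectation for every k, and Young's inequality
    alpha sigma xi <= e (alpha sigma) ^ 2 + xi ^ 2 / (4 e) then bounds the
    excess by e alpha Var plus a constant, with e as small as desired
    ([location_scale_risk_le]). Both claims on the bias follow, the constants
    depending on N, on the law of xi and on the mixture class only.

    For consistency, Chebyshev's inequality applied to exp (alpha loss) brings
    the empirical risk close to the true risk. Applied conditionally to the
    draws from the calibrated law, it shows that the correction is close to 0
    as soon as N is large, uniformly over the samples with s <= S
    ([bias_correction_small]); and s <= S has probability close to 1 for S large,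
    by Markov's inequality. Convergence in probability speaks of the measure of
    an event, so here the estimator has to be measurable: the laws of the draws
    form a probability kernel indexed by the scenarios, and a median of a
    measurable function under a kernel is measurable ([measurable_median]). *)

(** * Products of independent random variables *)

Definition mfun_of d d' (T : measurableType d) (T' : measurableType d')
    (f : T -> T') (mf : measurable_fun setT f) : {mfun T >-> T'} :=
  HB.pack f (isMeasurableFun.Build _ _ _ _ f mf).

Definition pair_independent d d' (T : measurableType d)
    (T' : measurableType d') (R : realType) (P : probability T R)
    (X Y : T -> T') :=
  forall A B, measurable A -> measurable B ->
    P (X @^-1` A `&` Y @^-1` B) = P (X @^-1` A) * P (Y @^-1` B).

Section product_of_independent.
Context d (T : measurableType d) (R : realType) (P : probability T R).
Implicit Types X Y : {mfun T >-> R}.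

(** On rectangles, independence says that the law of the pair is the product of
    the two laws; rectangles determine a measure, and Fubini's theorem
    concludes. *)
Lemma integral_mul_independent X Y : pair_independent P X Y ->
  P.-integrable setT (EFin \o X) -> P.-integrable setT (EFin \o Y) ->
  P.-integrable setT (fun t => (X t * Y t)%:E) ->
  \int[P]_t (X t * Y t)%:E = (\int[P]_t (X t)%:E) * (\int[P]_t (Y t)%:E).
Proof.
move=> XY iX iY iXY.
have mZ : measurable_fun setT (fun t => (X t, Y t)).
  by apply/measurable_fun_pairP; split.
pose Z := mfun_of mZ.
pose m1 := distribution P X; pose m2 := distribution P Y.
have eqm : forall A, measurable A -> (m1 \x m2) A = distribution P Z A.
  apply: (@product_measure_unique _ _ _ _ _ m1 m2 (distribution P Z)) => A B mA mB.
  by rewrite -XY.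
pose f (p : R * R) := (p.1 * p.2)%:E.
have mf : measurable_fun setT f.
  by apply/measurable_EFinP; apply: measurable_funM.
have eqint g : \int[m1 \x m2]_p g p = \int[distribution P Z]_p g p.
  by apply: eq_measure_integral => A mA _; exact: eqm.
have if12 : (m1 \x m2).-integrable setT f.
  apply/integrableP; split => //.
  rewrite eqint ge0_integral_distribution//=.
    by case/integrableP: iXY.
  apply/measurable_EFinP; apply: measurableT_comp => //.
  exact/measurable_EFinP.
transitivity (\int[distribution P Z]_p f p).
  by rewrite integral_distribution.
rewrite -eqint -integral12_prod_meas1//.
transitivity (\int[m1]_x (x%:E * \int[P]_t (Y t)%:E)).
  apply: eq_integral => x _; rewrite /fubini_F /f /=.
  under eq_integral do rewrite EFinM.
  rewrite integralZl//; last first.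
    by apply: integrable_pushforward => //.
  by rewrite integral_distribution.
have [y yE] : exists y, \int[P]_t (Y t)%:E = y%:E.
  by exists (fine (\int[P]_t (Y t)%:E)); rewrite fineK// integrable_fin_num.
rewrite yE integralZr//; last by apply: integrable_pushforward.
by rewrite integral_distribution.
Qed.

End product_of_independent.

(** * Real expectations and sample means *)

(** The integral of a nonnegative function is a supremum over the simple
    functions below it, hence monotone for arbitrary functions. *)
Lemma le_integral_any d (T : measurableType d) (R : realType)
    (mu : {measure set T -> \bar R}) (f g : T -> \bar R) :
  (forall t, f t <= g t) -> \int[mu]_t f t <= \int[mu]_t g t.
Proof.
move=> fg; rewrite /integral !patch_setT; apply: leeB.
  apply: ge_ereal_sup => _ [h hf <-]; apply: ereal_sup_ubound => /=.
  exists h => // t; apply: le_trans (hf t) _.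
  exact: (@funepos_le _ _ setT f g (fun t _ => fg t) t (in_setT t)).
apply: ge_ereal_sup => _ [h hg <-]; apply: ereal_sup_ubound => /=.
exists h => // t; apply: le_trans (hg t) _.
exact: (@funeneg_le _ _ setT f g (fun t _ => fg t) t (in_setT t)).
Qed.

Section real_expectation.
Local Open Scope ring_scope.
Context d (T : measurableType d) (R : realType) (P : probability T R).
Implicit Types f g : T -> R.

Definition L1 f := P.-integrable setT (EFin \o f).

Lemma L1_measurable f : L1 f -> measurable_fun setT f.
Proof. by move=> /measurable_int/measurable_EFinP. Qed.

Lemma EFin_mean f : L1 f ->
  (\int[P]_t (f t)%:E = (\int[P]_t f t)%:E)%E.
Proof. by move=> Lf; rewrite /Rintegral fineK//; exact: integrable_fin_num. Qed.

Lemma L1_le f g : measurable_fun setT f -> (forall t, `|f t| <= g t) ->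
  L1 g -> L1 f.
Proof.
move=> mf fg; apply: le_integrable => //; first exact/measurable_EFinP.
by move=> t _; rewrite /= lee_fin (le_trans (fg t))// ler_norm.
Qed.

Lemma ge0_L1 f (c : \bar R) : measurable_fun setT f -> (forall t, 0 <= f t) ->
  (\int[P]_t (f t)%:E <= c)%E -> (c < +oo)%E -> L1 f.
Proof.
move=> mf f0 fc coo; apply/integrableP; split; first exact/measurable_EFinP.
rewrite (le_lt_trans _ coo)// (le_trans _ fc)// le_eqVlt; apply/orP; left.
by apply/eqP; apply: eq_integral => t _; rewrite /= ger0_norm.
Qed.

Lemma L1_cst (c : R) : L1 (fun=> c).
Proof. exact: finite_measure_integrable_cst. Qed.

Lemma L1D f g : L1 f -> L1 g -> L1 (fun t => f t + g t).
Proof. by move=> Lf Lg; exact: integrableD Lf Lg. Qed.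

Lemma L1B f g : L1 f -> L1 g -> L1 (fun t => f t - g t).
Proof. by move=> Lf Lg; exact: integrableB Lf Lg. Qed.

Lemma L1Z (k : R) f : L1 f -> L1 (fun t => k * f t).
Proof. by move=> Lf; exact: integrableZl Lf. Qed.

Lemma L1_sum (I : Type) (s : seq I) (F : I -> T -> R) : (forall i, L1 (F i)) ->
  L1 (fun t => \sum_(i <- s) F i t).
Proof.
move=> LF; rewrite /L1.
have -> : EFin \o (fun t => \sum_(i <- s) F i t) =
    (fun t => \sum_(i <- s) (F i t)%:E)%E.
  by apply/funext => t /=; rewrite sumEFin.
by apply: (integrable_sum measurableT) => i _; exact: LF.
Qed.

Lemma mean_cst (c : R) : \int[P]_t c = c.
Proof. by rewrite Rintegral_cst//= probability_setT mulr1. Qed.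

Lemma meanD f g : L1 f -> L1 g ->
  \int[P]_t (f t + g t) = \int[P]_t f t + \int[P]_t g t.
Proof. by move=> Lf Lg; rewrite RintegralD. Qed.

Lemma meanB f g : L1 f -> L1 g ->
  \int[P]_t (f t - g t) = \int[P]_t f t - \int[P]_t g t.
Proof. by move=> Lf Lg; rewrite RintegralB. Qed.

Lemma meanZ (k : R) f : L1 f -> \int[P]_t (k * f t) = k * \int[P]_t f t.
Proof. by move=> Lf; rewrite RintegralZl. Qed.

Lemma mean_sum (I : Type) (s : seq I) (F : I -> T -> R) :
  (forall i, L1 (F i)) ->
  \int[P]_t (\sum_(i <- s) F i t) = \sum_(i <- s) \int[P]_t F i t.
Proof.
move=> LF; apply: EFin_inj; rewrite -EFin_mean; last exact: L1_sum.
under eq_integral do rewrite -sumEFin.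
rewrite integral_sum//= -sumEFin; apply: eq_bigr => i _.
by rewrite EFin_mean.
Qed.

Lemma le_mean f g : L1 f -> L1 g -> (forall t, f t <= g t) ->
  \int[P]_t f t <= \int[P]_t g t.
Proof. by move=> Lf Lg fg; apply: le_Rintegral => // t _. Qed.

Lemma L1_sqr f : measurable_fun setT f -> L1 (fun t => f t ^+ 2) -> L1 f.
Proof.
move=> mf Lf; apply: (@L1_le _ (fun t => 1 + f t ^+ 2)) => // [t|].
  have := sqr_ge0 (f t - 1); have := sqr_ge0 (f t + 1).
  by rewrite ler_norml => ? ?; apply/andP; split; nra.
by apply: L1D => //; exact: L1_cst.
Qed.

Lemma L1_mul f g : measurable_fun setT f -> measurable_fun setT g ->
  L1 (fun t => f t ^+ 2) -> L1 (fun t => g t ^+ 2) -> L1 (fun t => f t * g t).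
Proof.
move=> mf mg Lf Lg; apply: (@L1_le _ (fun t => f t ^+ 2 + g t ^+ 2)).
- exact: measurable_funM.
- move=> t; have := sqr_ge0 (f t - g t); have := sqr_ge0 (f t + g t).
  by rewrite ler_norml => ? ?; apply/andP; split; nra.
- exact: L1D.
Qed.

Lemma L1_sqr_dev f (c : R) : measurable_fun setT f ->
  L1 (fun t => f t ^+ 2) -> L1 (fun t => (f t - c) ^+ 2).
Proof.
move=> mf Lf.
have -> : (fun t => (f t - c) ^+ 2) = (fun t => f t ^+ 2 - (2 * c) * f t + c ^+ 2).
  by apply/funext => t; ring.
apply: L1D; last exact: L1_cst.
by apply: L1B => //; apply: L1Z; exact: L1_sqr.
Qed.

Lemma mean_sqr_dev_le f : measurable_fun setT f -> L1 (fun t => f t ^+ 2) ->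
  \int[P]_t ((f t - \int[P]_t f t) ^+ 2) <= \int[P]_t (f t ^+ 2).
Proof.
move=> mf Lf2; have Lf := L1_sqr mf Lf2; set c := \int[P]_t f t.
have -> : (fun t => (f t - c) ^+ 2) = (fun t => f t ^+ 2 - (2 * c) * f t + c ^+ 2).
  by apply/funext => t; ring.
rewrite meanD; [|by apply: L1B => //; exact: L1Z|exact: L1_cst].
rewrite meanB//; last exact: L1Z.
by rewrite meanZ// mean_cst -/c; have := sqr_ge0 c; nra.
Qed.

Lemma measurable_superlevel f (c : R) : measurable_fun setT f ->
  measurable [set t | c <= f t].
Proof.
move=> mf; rewrite (_ : mkset _ = f @^-1` `[c, +oo[).
  by rewrite -[X in measurable X]setTI; exact: mf.
by apply/seteqP; split => t /=; rewrite in_itv/= andbT.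
Qed.

Lemma markov_ge0 f (c t : R) : L1 f -> (forall x, 0 <= f x) ->
  \int[P]_x f x <= c -> 0 < t -> (P [set x | (t <= f x)%R] <= (c / t)%R%:E)%E.
Proof.
move=> Lf f0 fc t0; have mf := L1_measurable Lf.
have mA := measurable_superlevel t mf.
rewrite EFinM lee_pdivlMr//.
have -> : (P [set x | (t <= f x)%R] * t%:E =
    \int[P]_x (t * \1_[set x | (t <= f x)%R] x)%R%:E)%E.
  under eq_integral do rewrite EFinM.
  rewrite ge0_integralZl//.
  - by rewrite integral_indic// setIT muleC.
  - by apply/measurable_EFinP; apply: measurable_indic.
  - by rewrite lee_fin ltW.
apply: (@le_trans _ _ (\int[P]_x (f x)%:E)%E); last first.
  by rewrite EFin_mean// lee_fin.
apply: ge0_le_integral => //.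
- by move=> x _; rewrite lee_fin mulr_ge0// ltW.
- by apply/measurable_EFinP; apply: measurable_funM => //.
- by apply/measurable_EFinP.
- move=> x _; rewrite lee_fin indicE.
  by have [/[!inE]/= tf|_] := boolP (x \in _); rewrite ?mulr1// mulr0.
Qed.

End real_expectation.

Section sample_means.
Local Open Scope ring_scope.
Context d (T : measurableType d) (R : realType) (P : probability T R).
Variables (N : nat) (Y : 'I_N -> T -> R) (m v : R).
Hypothesis N_gt0 : (0 < N)%N.
Hypothesis mY : forall i, measurable_fun setT (Y i).
Hypothesis Y2 : forall i, L1 P (fun t => Y i t ^+ 2).
Hypothesis Ymean : forall i, \int[P]_t Y i t = m.
Hypothesis Yvar : forall i, \int[P]_t ((Y i t - m) ^+ 2) = v.
Hypothesis Yind : forall i j, i != j -> pair_independent P (Y i) (Y j).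

Let avg t := N%:R^-1 * \sum_i Y i t.

Let Z i t := Y i t - m.
Let LY i : L1 P (Y i). Proof. exact: L1_sqr. Qed.
Let mZ i : measurable_fun setT (Z i). Proof. exact: measurable_funB. Qed.
Let LZ2 i : L1 P (fun t => Z i t ^+ 2).
Proof. exact: L1_sqr_dev. Qed.
Let LZ i : L1 P (Z i). Proof. exact: L1_sqr. Qed.
Let LZZ i j : L1 P (fun t => Z i t * Z j t). Proof. exact: L1_mul. Qed.

Let Zmean i : \int[P]_t Z i t = 0.
Proof. by rewrite meanB//; [rewrite Ymean mean_cst subrr|exact: L1_cst]. Qed.

Let ZZmean i j : \int[P]_t (Z i t * Z j t) = (i == j)%:R * v.
Proof.
have [->|ij] := eqVneq i j; first by rewrite mul1r -(Yvar j).
apply: EFin_inj; rewrite -EFin_mean//.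
rewrite (@integral_mul_independent _ _ _ P (mfun_of (mZ i)) (mfun_of (mZ j)))//=.
- by rewrite !EFin_mean// !Zmean mul0r mule0.
- move=> A B mA mB.
  have mA' : measurable [set y | A (y - m)].
    by rewrite -[X in measurable X]setTI; apply: (measurable_funB _ _ measurableT mA).
  have mB' : measurable [set y | B (y - m)].
    by rewrite -[X in measurable X]setTI; apply: (measurable_funB _ _ measurableT mB).
  exact: Yind mA' mB'.
- exact: LZ.
- exact: LZ.
- exact: LZZ.
Qed.

Let avgE t : avg t - m = N%:R^-1 * \sum_i Z i t.
Proof.
rewrite /avg /Z big_split/= sumr_const card_ord mulrDr; congr (_ + _).
by rewrite mulNrn mulrN -[m *+ N]mulr_natl mulKf// pnatr_eq0 -lt0n.
Qed.

Let sqrE t : (avg t - m) ^+ 2 = N%:R^-2 * \sum_i \sum_j Z i t * Z j t.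
Proof.
rewrite avgE exprMn exprVn; congr (_ * _); rewrite expr2.
by rewrite mulr_suml; apply: eq_bigr => i _; rewrite mulr_sumr.
Qed.

Lemma L1_avg_sq : L1 P (fun t => (avg t - m) ^+ 2).
Proof.
have -> : (fun t => (avg t - m) ^+ 2) =
  (fun t => N%:R^-2 * \sum_i \sum_j Z i t * Z j t) by apply/funext.
by apply: L1Z; apply: L1_sum => i; exact: L1_sum.
Qed.

Lemma mean_avg : \int[P]_t avg t = m.
Proof.
rewrite meanZ; last exact: L1_sum.
rewrite mean_sum// (eq_bigr (fun=> m))// sumr_const card_ord.
by rewrite -[m *+ N]mulr_natl mulKf// pnatr_eq0 -lt0n.
Qed.

(** In the expansion of the square only the N diagonal terms survive, by
    independence. *)
Lemma mean_avg_sq : \int[P]_t ((avg t - m) ^+ 2) = v / N%:R.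
Proof.
under eq_Rintegral do rewrite sqrE.
rewrite meanZ; last by apply: L1_sum => i; exact: L1_sum.
rewrite mean_sum; last by move=> i; exact: L1_sum.
rewrite (eq_bigr (fun=> v)) => [|i _].
  rewrite sumr_const card_ord -[v *+ N]mulr_natl.
  by field; rewrite pnatr_eq0 -lt0n.
rewrite mean_sum// (bigD1 i)//= ZZmean eqxx mul1r big1 ?addr0// => j ji.
by rewrite ZZmean eq_sym (negbTE ji) mul0r.
Qed.

(** Chebyshev's inequality, the variance of the sample mean being [v / N]. *)
Lemma weak_law e : 0 < e ->
  (P [set t | (e <= `|avg t - m|)%R] <= (v / (N%:R * e ^+ 2))%R%:E)%E.
Proof.
move=> e0.
have -> : [set t | e <= `|avg t - m|] = [set t | e ^+ 2 <= (avg t - m) ^+ 2].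
  apply/funext => t /=; congr is_true.
  by rewrite -(real_normK (num_real (avg t - m))) ler_sqr ?nnegrE// ltW.
rewrite invfM mulrA; apply: markov_ge0.
- exact: L1_avg_sq.
- by move=> t; exact: sqr_ge0.
- by rewrite mean_avg_sq.
- by rewrite exprn_gt0.
Qed.

End sample_means.

(** * Moment generating functions of Gaussian mixtures *)

Section gaussian_moment_generating_function.
Local Open Scope ring_scope.
Context (R : realType).
Implicit Types m s t : R.

(** The density of [normal_prob] agrees almost everywhere with its
    Radon-Nikodym derivative, for which the formula is known. *)
Lemma integral_normal_prob m s (f : R -> \bar R) :
  measurable_fun setT f -> (forall x, 0 <= f x)%E ->
  (\int[normal_prob m s]_x f x =
   \int[lebesgue_measure]_x (f x * (normal_pdf m s x)%:E))%E.
Proof.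
move=> mf f0; have dom := @normal_prob_dominates R m s.
rewrite -(Radon_Nikodym_SigmaFinite.change_of_variables dom)//.
have mpdf : measurable_fun setT (fun x => (normal_pdf m s x)%:E).
  by apply/measurable_EFinP; exact: measurable_normal_pdf.
have iRN := Radon_Nikodym_SigmaFinite.f_integrable dom.
apply: ge0_ae_eq_integral => //.
- by apply: emeasurable_funM => //; exact: measurable_int iRN.
- by apply: emeasurable_funM.
- by move=> x _; rewrite mule_ge0//; exact: Radon_Nikodym_SigmaFinite.f_ge0.
- by move=> x _; rewrite mule_ge0// lee_fin normal_pdf_ge0.
- apply: ae_eqe_mul2l => /=; apply: integral_ae_eq => //.
  by move=> E _ mE; rewrite -Radon_Nikodym_SigmaFinite.f_integral.
Qed.

(* [gauss] lives on R and [normal_prob] on the measurable type generated by the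
   intervals: the same sigma-algebra under two names, bridged by the identity. *)
Let idTR : measurableTypeR R -> R := idfun.

Let measurable_idTR : measurable_fun setT idTR.
Proof. by move=> _ A mA; rewrite setTI. Qed.

Lemma measurable_expM t : measurable_fun setT (fun x : R => expR (t * x)).
Proof. by apply: measurableT_comp => //; exact: measurable_funM. Qed.

Lemma mgf_gauss m s t :
  (\int[gauss m s]_x (expR (t * x))%:E =
   (expR (t * m + (t * s) ^+ 2 / 2))%:E)%E.
Proof.
have mexp : measurable_fun setT (fun x : R => (expR (t * x))%:E).
  by apply/measurable_EFinP; exact: measurable_expM.
have [s0|s0] := eqVneq s 0.
  rewrite (@eq_measure_integral _ _ _ _ (\d_m)); last first.
    by move=> A _ _; rewrite /= /gauss s0 eqxx.
  by rewrite integral_dirac// diracT mul1e s0 mulr0 expr0n/= mul0r addr0.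
rewrite (@eq_measure_integral _ _ _ _ (pushforward (normal_prob m s) idTR)); last first.
  by move=> A _ _; rewrite /= /gauss (negbTE s0).
rewrite ge0_integral_pushforward//= preimage_setT /idTR/=.
rewrite integral_normal_prob//.
(* completing the square: tilting N(m, s^2) by exp (t x) shifts its mean *)
pose m' := m + t * s ^+ 2.
have tilt x : expR (t * x) * normal_pdf m s x =
    expR (t * m + (t * s) ^+ 2 / 2) * normal_pdf m' s x.
  rewrite !normal_pdfE// /normal_fun mulrCA [RHS]mulrCA; congr (_ * _).
  by rewrite -!expRD /m'; congr expR; field.
under eq_integral do rewrite -EFinM tilt EFinM.
rewrite ge0_integralZl//.
- by rewrite integral_normal_pdf mule1.
- by apply/measurable_EFinP; exact: measurable_normal_pdf.
- by move=> x _; rewrite lee_fin normal_pdf_ge0.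
Qed.

End gaussian_moment_generating_function.

Section mixture_moment_generating_function.
Local Open Scope ring_scope.
Context (R : realType) (J : nat).
Implicit Types theta : gmm_param R J.

Lemma ge0_integral_gmm theta (f : R -> \bar R) :
  measurable_fun setT f -> (forall x, 0 <= f x)%E ->
  (\int[gmm theta]_x f x =
   \sum_(j < J) (tnth (weights theta) j)%:E *
     \int[gauss (tnth (means theta) j) (tnth (sdevs theta) j)]_x f x)%E.
Proof.
move=> mf f0.
case: J theta => [|n] theta.
  by have := weights_sum1 theta; rewrite big_ord0 => /esym/eqP; rewrite oner_eq0.
pose w j : {nonneg R} := NngNum (weights_ge0 theta j).
pose mu (k : nat) : {measure set R -> \bar R} := mscale (w (inord k))
  (gauss (tnth (means theta) (inord k)) (tnth (sdevs theta) (inord k))).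
rewrite (@eq_measure_integral _ _ _ _ (msum mu n.+1)); last first.
  move=> A _ _; rewrite /= /gmm /msum; apply: eq_bigr => j _.
  by rewrite /mu/= /mscale/= inord_val.
rewrite ge0_integral_measure_sum//; apply: eq_bigr => j _.
rewrite /mu inord_val.
pose g := gauss (tnth (means theta) j) (tnth (sdevs theta) j).
exact: (@ge0_integral_mscale _ _ _ g setT measurableT (w j) f).
Qed.

Definition mix_mgf theta (t : R) : R := \sum_(j < J) tnth (weights theta) j *
  expR (t * tnth (means theta) j + (t * tnth (sdevs theta) j) ^+ 2 / 2).

Lemma mgf_gmm theta (t : R) :
  (\int[gmm theta]_x (expR (t * x))%:E = (mix_mgf theta t)%:E)%E.
Proof.
rewrite ge0_integral_gmm//.
  by rewrite -sumEFin; apply: eq_bigr => j _; rewrite mgf_gauss EFinM.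
by apply/measurable_EFinP; exact: measurable_expM.
Qed.

Lemma mix_mgf_le theta (B t : R) :
  (forall j, tnth (sdevs theta) j <= B) ->
  (forall j, `|tnth (means theta) j| <= B) ->
  mix_mgf theta t <= expR (`|t| * B + (t * B) ^+ 2 / 2).
Proof.
move=> sB mB.
rewrite -[leRHS]mul1r -[X in X * _](weights_sum1 theta) mulr_suml.
apply: ler_sum => j _; rewrite ler_wpM2l ?weights_ge0// ler_expR.
have s0 := sdevs_ge0 theta j; have sj := sB j.
apply: lerD.
  by rewrite (le_trans (ler_norm _))// normrM ler_wpM2l.
rewrite ler_wpM2r ?invr_ge0// !exprMn ler_wpM2l ?sqr_ge0//.
by rewrite ler_sqr ?nnegrE// (le_trans s0).
Qed.

(** The j-th component alone accounts for the bound. *)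
Lemma mix_mgf_ge theta (eps b t : R) (j : 'I_J) : 0 < eps -> 0 <= t ->
  eps <= tnth (weights theta) j -> b <= tnth (means theta) j ->
  eps <= tnth (sdevs theta) j ->
  eps * expR (t * b + (t * eps) ^+ 2 / 2) <= mix_mgf theta t.
Proof.
move=> e0 t0 ew bm es; rewrite /mix_mgf (bigD1 j)//=.
rewrite -[leLHS]addr0 lerD//; last first.
  by apply: sumr_ge0 => i _; rewrite mulr_ge0 ?expR_ge0 ?weights_ge0.
rewrite ler_pM ?expR_ge0 ?(ltW e0)// ler_expR lerD ?ler_wpM2l//.
rewrite ler_wpM2r// !exprMn ler_wpM2l ?sqr_ge0//.
by rewrite ler_sqr ?nnegrE ?(ltW e0)// (le_trans (ltW e0)).
Qed.

End mixture_moment_generating_function.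

(** * Laws of i.i.d. draws *)

Section transfer_of_laws.
Local Open Scope ring_scope.
Context d d' (T : measurableType d) (T' : measurableType d') (R : realType).
Context (P : probability T R) (Q : probability T' R) (X : T -> T').
Hypothesis mX : measurable_fun setT X.
Hypothesis lawX : forall A, measurable A -> P (X @^-1` A) = Q A.
Implicit Types f : T' -> R.

Lemma ge0_integral_law (f : T' -> \bar R) :
  measurable_fun setT f -> (forall y, 0 <= f y)%E ->
  (\int[P]_t f (X t) = \int[Q]_y f y)%E.
Proof.
move=> mf f0.
transitivity (\int[distribution P (mfun_of mX)]_y f y)%E.
  by rewrite ge0_integral_distribution.
by apply: eq_measure_integral => A mA _; exact: lawX.
Qed.

Lemma L1_law f : L1 Q f -> L1 P (f \o X).
Proof.
move=> Lf; have mf := L1_measurable Lf.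
apply/integrableP; split; first by apply/measurable_EFinP; exact: measurableT_comp.
rewrite (ge0_integral_law (f := fun y => `|(f y)%:E|%E))//.
  by case/integrableP : Lf.
by apply: measurableT_comp => //; exact/measurable_EFinP.
Qed.

Lemma mean_law f : L1 Q f -> \int[P]_t f (X t) = \int[Q]_y f y.
Proof.
move=> Lf; have mf := L1_measurable Lf; congr fine.
transitivity (\int[distribution P (mfun_of mX)]_y (f y)%:E)%E.
  rewrite integral_distribution//; last exact: L1_law.
  exact/measurable_EFinP.
by apply: eq_measure_integral => A mA _; exact: lawX.
Qed.

End transfer_of_laws.

Lemma pair_independent_comp d d' d'' (T : measurableType d)
    (T' : measurableType d') (T'' : measurableType d'') (R : realType)
    (P : probability T R) (X Y : T -> T') (f : T' -> T'') :
  measurable_fun setT f -> pair_independent P X Y ->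
  pair_independent P (f \o X) (f \o Y).
Proof.
move=> mf XY A B mA mB; apply: (XY (f @^-1` A) (f @^-1` B)).
  by rewrite -[X in measurable X]setTI; exact: mf.
by rewrite -[X in measurable X]setTI; exact: mf.
Qed.

Section coordinates_of_iid_draws.
Context (R : realType) (Q : probability R R).

Let cons_preim n (A : set R) (B : set (n.-tuple R)) :
  measurable A -> measurable B ->
  (Q \x iid_law Q n) (A `*` B) = Q A * iid_law Q n B.
Proof. by move=> mA mB; rewrite product_measure1E. Qed.

Let mcoord n (i : 'I_n) (A : set R) : measurable A ->
  measurable [set x : n.-tuple R | A (tnth x i)].
Proof.
move=> mA; have := @measurable_tnth _ R n i measurableT A mA.
by rewrite setTI.
Qed.

Lemma iid_law_coord n (i : 'I_n) (A : set R) : measurable A ->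
  iid_law Q n [set x | A (tnth x i)] = Q A.
Proof.
elim: n i => [[]//|n IH] i mA; rewrite /= /distribution /pushforward.
have [->|] := eqVneq i ord0.
  rewrite (_ : _ @^-1` _ = A `*` setT).
    by rewrite cons_preim// probability_setT mule1.
  by apply/seteqP; split => [[r y]|[r y]] /=; [|case].
case: (unliftP ord0 i) => [j ->|->]; last by rewrite eqxx.
move=> _; rewrite (_ : _ @^-1` _ = setT `*` [set y | A (tnth y j)]).
  by rewrite cons_preim//; [rewrite IH// probability_setT mul1e|exact: mcoord].
by apply/seteqP; split => [[r y]|[r y]] /=; rewrite tnthS//; case.
Qed.

Lemma iid_law_independent n (i j : 'I_n) : i != j ->
  pair_independent (iid_law Q n) (@tnth n R ^~ i) (@tnth n R ^~ j).
Proof.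
elim: n i j => [[]//|n IH] i j ij A B mA mB.
rewrite !(iid_law_coord _ mA, iid_law_coord _ mB).
wlog i0 : i j A B mA mB ij / (j != ord0).
  move=> wl; have [j0|] := eqVneq j ord0; last exact: wl.
  by rewrite setIC muleC; apply: wl => //; [rewrite eq_sym|rewrite -j0].
case: (unliftP ord0 j) i0 ij => [j' ->|->]; last by rewrite eqxx.
move=> _; rewrite /= /distribution /pushforward.
case: (unliftP ord0 i) => [i' ->|->] ij.
  rewrite (_ : _ @^-1` _ =
    setT `*` ([set y | A (tnth y i')] `&` [set y | B (tnth y j')])).
    rewrite cons_preim//; last by apply: measurableI; exact: mcoord.
    by rewrite probability_setT mul1e IH// ?iid_law_coord//.
  by apply/seteqP; split => [[r y]|[r y]] /=; rewrite !tnthS//; case.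
rewrite (_ : _ @^-1` _ = A `*` [set y | B (tnth y j')]).
  by rewrite cons_preim//; [rewrite iid_law_coord|exact: mcoord].
by apply/seteqP; split => [[r y]|[r y]] /=; rewrite !tnthS.
Qed.

End coordinates_of_iid_draws.

(** * Entropic risks of samples, and medians *)

Section entropic_risk_formulas.
Local Open Scope ring_scope.
Context (R : realType) (alpha : R).
Hypothesis alpha_gt0 : 0 < alpha.

Lemma entropic_riskE d (T : measurableType d) (Q : set T -> \bar R) (X : T -> R)
    (M : R) : 0 < M -> (\int[Q]_t (expR (alpha * X t))%:E = M%:E)%E ->
  entropic_risk alpha Q X = (alpha^-1 * ln M)%:E.
Proof. by move=> M0 QM; rewrite /entropic_risk QM lne_EFin// EFinM. Qed.

(** The entropic risk of the empirical law of [u]. *)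
Definition sample_risk (N : nat) (u : 'I_N -> R) : R :=
  alpha^-1 * ln (N%:R^-1 * \sum_i expR (alpha * u i)).

Lemma avg_expR_gt0 (N : nat) (u : 'I_N -> R) : (0 < N)%N ->
  0 < N%:R^-1 * \sum_i expR (alpha * u i).
Proof.
case: N u => // n u _; rewrite mulr_gt0// ?invr_gt0 ?ltr0n//.
rewrite big_ord_recl ltr_pwDl ?expR_gt0//.
by apply: sumr_ge0 => i _; exact: expR_ge0.
Qed.

Lemma entropic_risk_empirical d (T : measurableType d) (N : nat) (x : nat -> T)
    (L : T -> R) : (0 < N)%N -> measurable_fun setT L ->
  entropic_risk alpha (empirical R N x) L = (sample_risk (fun i : 'I_N => L (x i)))%:E.
Proof.
move=> N0 mL; apply: entropic_riskE; first exact: avg_expR_gt0.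
have mexp : measurable_fun setT (fun t => (expR (alpha * L t))%:E).
  by apply/measurable_EFinP; apply: measurableT_comp => //; exact: measurable_funM.
rewrite /empirical ge0_integral_mscale//= ge0_integral_measure_sum//.
rewrite EFinM -sumEFin; congr (_ * _)%E; apply: eq_bigr => i _.
by rewrite integral_dirac// diracT mul1e.
Qed.

(** Jensen's inequality, from the tangent line of the exponential. *)
Lemma sample_risk_ge_mean (N : nat) (u : 'I_N -> R) : (0 < N)%N ->
  N%:R^-1 * \sum_i u i <= sample_risk u.
Proof.
move=> N0; set a := N%:R^-1 * _.
have NR0 : (0 : R) < N%:R by rewrite ltr0n.
rewrite /sample_risk ler_pdivlMl//.
rewrite -[leLHS]expRK ler_ln ?posrE ?expR_gt0 ?avg_expR_gt0//.
rewrite ler_pdivlMl//.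
have -> : N%:R * expR (alpha * a) =
    \sum_(i < N) expR (alpha * a) * (1 + alpha * (u i - a)).
  rewrite -mulr_sumr big_split/= sumr_const card_ord -mulr_sumr sumrB.
  rewrite sumr_const card_ord -[a *+ N]mulr_natl /a mulVKf ?gt_eqF//.
  by rewrite subrr mulr0 addr0 mulrC.
apply: ler_sum => i _.
have -> : alpha * u i = alpha * a + alpha * (u i - a) by ring.
by rewrite expRD ler_wpM2l ?expR_ge0// expR_ge1Dx.
Qed.

Lemma sample_risk_le (N : nat) (u : 'I_N -> R) (b : R) : (0 < N)%N ->
  (forall i, u i <= b) -> sample_risk u <= b.
Proof.
move=> N0 ub; have NR0 : (0 : R) < N%:R by rewrite ltr0n.
rewrite /sample_risk ler_pdivrMl//.
rewrite -[leRHS]expRK ler_ln ?posrE ?expR_gt0 ?avg_expR_gt0//.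
rewrite ler_pdivrMl// mulr_natl -[in leRHS](card_ord N) -sumr_const.
by apply: ler_sum => i _; rewrite ler_expR ler_wpM2l// ltW.
Qed.

End entropic_risk_formulas.

Lemma half_lt_compl (R : realType) (p : R) :
  (2^-1 < p -> 2^-1 <= 1 - p -> False)%R.
Proof. by move=> *; lra. Qed.

(** A median is compared with a constant through a single event of probability
    above one half. *)
Section median_bounds.
Context d (T : measurableType d) (R : realType) (P : probability T R).
Variables (X : T -> \bar R) (E : set T).
Hypothesis mE : measurable E.

Lemma median_ge (a : \bar R) : measurable_fun setT X ->
  (2^-1)%:E < P E -> (forall t, E t -> a <= X t) -> a <= median P X.
Proof.
move=> mX PE EX; apply: le_ereal_inf_tmp => m /= Pm.
rewrite leNgt; apply/negP => ma.
have sub : [set t | X t <= m] `<=` ~` E.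
  by move=> t /= Xm Et; have := le_lt_trans Xm ma; rewrite ltNge EX.
have : P [set t | X t <= m] <= P (~` E).
  apply: le_measure => //; rewrite inE; last exact: measurableC.
  by rewrite -[X in measurable X]setTI; exact: emeasurable_fun_infty_c.
rewrite probability_setC// => /(le_trans Pm).
have fE : P E \is a fin_num by exact: fin_num_measure.
rewrite -(fineK fE) in PE *; move: PE; rewrite -EFinB lee_fin lte_fin.
exact: half_lt_compl.
Qed.

Lemma median_le (b : \bar R) : measurable [set t | X t <= b] ->
  (2^-1)%:E <= P E -> (forall t, E t -> X t <= b) -> median P X <= b.
Proof.
move=> mb PE EX; apply: ereal_inf_lbound; rewrite /=.
by rewrite (le_trans PE)// le_measure// ?inE.
Qed.

End median_bounds.

(** * The size of the bias correction *)

Section elementary_estimates.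
Local Open Scope ring_scope.

Lemma ln_le_subr1 (R : realType) (x : R) : 0 < x -> ln x <= x - 1.
Proof.
by move=> x0; have := @le_ln1Dx R (x - 1); rewrite subrKC; apply; rewrite ltrBrDl subrr.
Qed.

(** Errors on an exponential moment are measured relatively to it, since only its
    logarithm matters. *)
Lemma ln_close (R : realType) (p a e : R) : 0 < p -> 0 < e -> e <= 2^-1 ->
  `|a - p| < e * p -> 0 < a /\ `|ln p - ln a| <= 2 * e.
Proof.
move=> p0 e0 e2; rewrite ltr_norml => /andP[h1 h2].
have a0 : 0 < a by nra.
split => //; rewrite -ln_div ?posrE// ler_norml; apply/andP; split.
  rewrite lerNl -lnV ?posrE ?divr_gt0// invfM invrK mulrC.
  apply: le_trans (ln_le_subr1 _) _; first by rewrite divr_gt0.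
  by rewrite lerBlDr ler_pdivrMr//; nra.
apply: le_trans (ln_le_subr1 _) _; first by rewrite divr_gt0.
by rewrite lerBlDr ler_pdivrMr//; nra.
Qed.

(** Turns bounds on the moment generating function into a bound on the second
    moment. *)
Lemma sqr_le_expR (R : realType) (x : R) : x ^+ 2 <= 4 * (expR (1 * x) + expR (- 1 * x)).
Proof.
have h (y : R) : 0 <= y -> y ^+ 2 <= 4 * expR y.
  move=> y0; have := expR_ge1Dx (y / 2) => h1.
  have -> : expR y = expR (y / 2) ^+ 2 by rewrite expr2 -expRD; congr expR; field.
  have := expR_gt0 (y / 2); nra.
rewrite mul1r mulN1r; have [x0|x0] := leP 0 x.
  by have := h x x0; have := expR_ge0 (- x); nra.
have := h (- x); rewrite sqrrN oppr_ge0 => /(_ (ltW x0)).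
by have := expR_ge0 x; nra.
Qed.

End elementary_estimates.

Lemma half_lt_prob_compl d (T : measurableType d) (R : realType) (P : probability T R)
    (E : set T) (q : R) : measurable E -> P E <= q%:E -> (q < 2^-1)%R ->
  (2^-1)%:E < P (~` E).
Proof.
move=> mE PE q2; rewrite probability_setC//.
have fE : P E \is a fin_num by exact: fin_num_measure.
rewrite -(fineK fE) -EFinB lte_fin; rewrite -(fineK fE) lee_fin in PE.
by move: (fine _) PE => p PE; lra.
Qed.

Lemma abse_le (R : realType) (x : \bar R) (c : R) :
  (- c)%:E <= x -> x <= c%:E -> `|x| <= c%:E.
Proof. by case: x => [r||]//=; rewrite !lee_fin ler_norml => -> ->. Qed.

(** For N draws y from the law of m + s * x with x drawn from the mixture,
    this is the entropic risk of that law minus the one of the empirical law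
    of y. *)
Definition risk_gap (R : realType) (alpha : R) (J : nat) (theta : gmm_param R J)
    (m s : R) (N : nat) (y : N.-tuple R) : R :=
  (alpha^-1 * (ln (mix_mgf theta (alpha * s)) -
    ln (N%:R^-1 * \sum_i expR (alpha * (tnth y i - m)))))%R.

Section bias_of_affine_mixture.
Local Open Scope ring_scope.
Context (R : realType) (alpha : R) (J : nat) (theta : gmm_param R J).
Hypothesis alpha_gt0 : 0 < alpha.
Variables (B : R) (eps b : R) (j0 : 'I_J).
Hypothesis sB : forall j, tnth (sdevs theta) j <= B.
Hypothesis mB : forall j, `|tnth (means theta) j| <= B.
Hypothesis eps_gt0 : 0 < eps.
Hypothesis weight_ge : eps <= tnth (weights theta) j0.
Hypothesis mean_ge : b <= tnth (means theta) j0.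
Hypothesis sdev_ge : eps <= tnth (sdevs theta) j0.
Variables (m s : R) (N : nat).
Hypothesis s_ge0 : 0 <= s.
Hypothesis N_gt0 : (0 < N)%N.

Let Q : probability R R := distribution (gmm theta) (affine m s).
Let M t := mix_mgf theta t.

Let lawQ A : measurable A -> gmm theta (affine m s @^-1` A) = Q A.
Proof. by []. Qed.

Let law_coord (i : 'I_N) A : measurable A ->
  iid_law Q N ((@tnth N R ^~ i) @^-1` A) = Q A.
Proof. by move=> mA; exact: iid_law_coord. Qed.

Let maff : measurable_fun setT (affine m s).
Proof. exact: measurable_affine. Qed.

Let mcoord (i : 'I_N) : measurable_fun setT (@tnth N R ^~ i).
Proof. exact: measurable_tnth. Qed.

Lemma L1_gmm_expR t : L1 (gmm theta) (fun x => expR (t * x)).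
Proof.
apply: (@ge0_L1 _ _ _ _ _ (M t)%:E).
- exact: measurable_expM.
- by move=> x; exact: expR_ge0.
- by rewrite mgf_gmm.
- exact: ltry.
Qed.

Lemma mean_gmm_expR t : \int[gmm theta]_x expR (t * x) = M t.
Proof. by apply: EFin_inj; rewrite -EFin_mean ?mgf_gmm//; exact: L1_gmm_expR. Qed.

Lemma mix_mgf_gt0 t : 0 < M t.
Proof.
rewrite lt_neqAle; apply/andP; split; last first.
  by rewrite -mean_gmm_expR; apply: Rintegral_ge0 => x _; exact: expR_ge0.
apply/eqP => M0.
have := weights_ge0 theta; have w0 : 0 < tnth (weights theta) j0.
  exact: lt_le_trans weight_ge.
move=> w; suff : 0 < M t by rewrite -M0 ltxx.
rewrite /M /mix_mgf (bigD1 j0)//= ltr_pwDl ?mulr_gt0 ?expR_gt0//.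
by apply: sumr_ge0 => i _; rewrite mulr_ge0 ?expR_ge0.
Qed.

Let shifted_exp t (x : R) : expR (t * (affine m s x - m)) = expR (t * s * x).
Proof. by rewrite /affine; congr expR; ring. Qed.

Let mexp t : measurable_fun setT (fun x : R => expR (t * (x - m))).
Proof.
apply: measurableT_comp => //; apply: measurable_funM => //.
exact: measurable_funB.
Qed.

Let L1_exp t : L1 Q (fun x => expR (t * (x - m))).
Proof.
apply: (@ge0_L1 _ _ _ _ _ (M (t * s))%:E) => //; last exact: ltry.
rewrite -(ge0_integral_law maff lawQ (f := fun x => (expR (t * (x - m)))%:E))//.
  by under eq_integral do rewrite shifted_exp; rewrite mgf_gmm.
by apply/measurable_EFinP.
Qed.

Let mean_exp t : \int[Q]_x expR (t * (x - m)) = M (t * s).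
Proof.
rewrite -(mean_law maff lawQ (L1_exp t)).
by under eq_Rintegral do rewrite shifted_exp; rewrite mean_gmm_expR.
Qed.

Let avg (y : N.-tuple R) := N%:R^-1 * \sum_i expR (alpha * (tnth y i - m)).

Let avg_gt0 y : 0 < avg y. Proof. exact: avg_expR_gt0. Qed.

Let gap (y : N.-tuple R) := risk_gap alpha theta m s y.

Let gapE y : gap y = alpha^-1 * (ln (M (alpha * s)) - ln (avg y)).
Proof. by []. Qed.

Let measurable_avgy : measurable_fun setT avg.
Proof.
apply: measurable_funM => //; apply: measurable_sum => i.
by apply: (measurableT_comp (mexp alpha)); exact: measurable_tnth.
Qed.

Let measurable_gap : measurable_fun setT (EFin \o gap).
Proof.
apply/measurable_EFinP; apply: measurable_funM => //; apply: measurable_funB => //.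
by apply: measurableT_comp => //; exact: measurable_ln.
Qed.

(** The risk of an affine mixture and the risk of a sample both shift with the
    location [m], which cancels out in their difference. *)
Lemma bias_correctionE :
  bias_correction alpha N Q = median (iid_law Q N) (EFin \o gap).
Proof.
rewrite /bias_correction; congr median; apply/funext => y.
rewrite entropic_risk_empirical//; last exact: measurable_id.
have MQ : (\int[Q]_x (expR (alpha * idfun x))%:E =
    (expR (alpha * m) * M (alpha * s))%:E)%E.
  have -> : (fun x : R => (expR (alpha * idfun x))%:E) =
      (fun x => (expR (alpha * m))%:E * (expR (alpha * (x - m)))%:E)%E.
    by apply/funext => x; rewrite -EFinM -expRD; congr (expR _)%:E => /=; ring.
  rewrite ge0_integralZl//; last exact/measurable_EFinP.
  by rewrite EFin_mean// mean_exp.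
rewrite (entropic_riskE _ MQ) ?mulr_gt0 ?expR_gt0 ?mix_mgf_gt0//.
rewrite -EFinB /= /sample_risk; congr EFin.
have -> : N%:R^-1 * \sum_(i < N) expR (alpha * nth 0 y i) = expR (alpha * m) * avg y.
  rewrite /avg mulrCA; congr (_ * _); rewrite mulr_sumr; apply: eq_bigr => i _.
  by rewrite (tnth_nth 0) -expRD; congr expR; ring.
rewrite lnM ?posrE ?expR_gt0 ?mix_mgf_gt0//.
rewrite lnM ?posrE ?expR_gt0 ?avg_gt0//.
by rewrite gapE; ring.
Qed.

Let V := 8 * expR (B + B ^+ 2 / 2).

Let L1_sqr_gmm : L1 (gmm theta) (fun x => x ^+ 2).
Proof.
apply: (@L1_le _ _ _ (gmm theta) _ (fun x : R => 4 * (expR (1 * x) + expR (- 1 * x)))).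
- exact: exprn_measurable.
- by move=> x; rewrite ger0_norm ?sqr_ge0// sqr_le_expR.
- by apply: L1Z; apply: L1D; exact: L1_gmm_expR.
Qed.

Let sqr_gmm_le : \int[gmm theta]_x (x ^+ 2) <= V.
Proof.
apply: (@le_trans _ _ (\int[gmm theta]_x (4 * (expR (1 * x) + expR (- 1 * x))))).
  apply: le_mean => //; last exact: sqr_le_expR.
  by apply: L1Z; apply: L1D; exact: L1_gmm_expR.
rewrite meanZ; last by apply: L1D; exact: L1_gmm_expR.
rewrite meanD; [|exact: L1_gmm_expR..].
rewrite !mean_gmm_expR.
have := mix_mgf_le 1 sB mB; have := mix_mgf_le (- 1) sB mB.
rewrite normrN normr1 !mul1r mulN1r sqrrN /M /V => h1 h2.
by move: h1 h2; move: (mix_mgf _ _) (mix_mgf _ _) (expR _) => x y z h1 h2; nra.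
Qed.

Let msq : measurable_fun setT (fun x : R => (x - m) ^+ 2).
Proof. by apply: measurable_funX; exact: measurable_funB. Qed.

Let sqE (x : R) : (affine m s x - m) ^+ 2 = s ^+ 2 * x ^+ 2.
Proof. by rewrite /affine; ring. Qed.

Let L1_sqr_Q : L1 Q (fun x => (x - m) ^+ 2).
Proof.
apply: (@ge0_L1 _ _ _ _ _ (s ^+ 2 * \int[gmm theta]_x (x ^+ 2))%:E) => //.
- by move=> x; exact: sqr_ge0.
- rewrite -(ge0_integral_law maff lawQ (f := fun x => ((x - m) ^+ 2)%:E)).
  + under eq_integral do rewrite sqE.
    by rewrite EFin_mean; [rewrite meanZ|exact: L1Z].
  + exact/measurable_EFinP.
  + by move=> x; rewrite lee_fin sqr_ge0.
- exact: ltry.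
Qed.

Let sqr_Q_le : \int[Q]_x ((x - m) ^+ 2) <= s ^+ 2 * V.
Proof.
rewrite -(mean_law maff lawQ L1_sqr_Q).
under eq_Rintegral do rewrite sqE.
by rewrite meanZ// ler_wpM2l ?sqr_ge0.
Qed.

(** Half-width, in units of [s + 1], of an interval around [m] that contains all
    the N draws with probability above one half. Markov's inequality for the sum
    of the squared deviations yields it: 8 exp (B + B^2/2) bounds the second
    moment of the mixture. The unit is [s + 1] and not [s] in order to cover the
    degenerate case [s = 0]. *)
Definition spread : R := 2 * N%:R * (8 * expR (B + B ^+ 2 / 2) + 1).

Lemma spread_ge0 : 0 <= spread.
Proof. by rewrite /spread !mulr_ge0// addr_ge0// mulr_ge0// expR_ge0. Qed.

Let sumsq (y : N.-tuple R) := \sum_i (tnth y i - m) ^+ 2.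

Let L1_sumsq : L1 (iid_law Q N) sumsq.
Proof.
apply: L1_sum => i.
exact: (L1_law (mcoord i) (law_coord i) L1_sqr_Q).
Qed.

Let close (y : N.-tuple R) := sumsq y < (spread * (s + 1)) ^+ 2.

Let close_setC :
  [set y | close y] = ~` [set y | (spread * (s + 1)) ^+ 2 <= sumsq y].
Proof. by apply/seteqP; split => y /=; rewrite /close ltNge => /negP. Qed.

Let measurable_close : measurable [set y | close y].
Proof.
rewrite close_setC; apply: measurableC.
exact: measurable_superlevel (L1_measurable L1_sumsq).
Qed.

Let prob_close : ((2^-1)%:E < iid_law Q N [set y | close y])%E.
Proof.
have t0 : 0 < (spread * (s + 1)) ^+ 2.
  rewrite exprn_gt0// mulr_gt0//; last by rewrite ltr_wpDl.
  by rewrite /spread !mulr_gt0 ?ltr0n// ltr_wpDl// mulr_ge0// expR_ge0.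
have mS : \int[iid_law Q N]_y sumsq y <= N%:R * (s ^+ 2 * V).
  rewrite mean_sum; last first.
    by move=> i; exact: (L1_law (mcoord i) (law_coord i) L1_sqr_Q).
  rewrite mulr_natl -[in leRHS](card_ord N) -sumr_const; apply: ler_sum => i _.
  by rewrite (mean_law (mcoord i) (law_coord i) L1_sqr_Q).
have := markov_ge0 L1_sumsq _ mS t0.
move=> /(_ (fun y => sumr_ge0 _ (fun i _ => sqr_ge0 _))) le_far.
rewrite close_setC.
have mfar := measurable_superlevel ((spread * (s + 1)) ^+ 2) (L1_measurable L1_sumsq).
apply: half_lt_prob_compl mfar le_far _.
(* N s^2 V is less than half of (2 N (V + 1) (s + 1))^2 *)
rewrite ltr_pdivrMr// /spread -/V.
have V0 : 0 <= V by rewrite mulr_ge0// expR_ge0.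
have N1 : 1 <= N%:R :> R by rewrite ler1n.
have s1 : s ^+ 2 <= (s + 1) ^+ 2 by rewrite ler_sqr ?nnegrE ?addr_ge0// lerDl.
have s2 : 1 <= (s + 1) ^+ 2 by rewrite expr_ge1 ?addr_ge0// lerDr.
apply: (@le_lt_trans _ _ (N%:R ^+ 2 * ((s + 1) ^+ 2 * V))).
  apply: ler_pM => //; first by rewrite mulr_ge0// sqr_ge0.
    by rewrite expr2 ler_peMl// ler0n.
  by rewrite ler_wpM2r.
rewrite (_ : 2^-1 * _ = N%:R ^+ 2 * ((s + 1) ^+ 2 * (2 * (V + 1) ^+ 2))); last by field.
rewrite !ltr_pM2l ?exprn_gt0// ?(lt_le_trans ltr01)//.
  by nra.
by rewrite lerDr.
Qed.

Let close_coord y i : close y -> `|tnth y i - m| <= spread * (s + 1).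
Proof.
move=> cy; rewrite -ler_sqr ?nnegrE ?mulr_ge0 ?spread_ge0 ?addr_ge0//.
rewrite real_normK ?num_real// (le_trans _ (ltW cy))// /sumsq (bigD1 i)//=.
by rewrite lerDl; apply: sumr_ge0 => k _; exact: sqr_ge0.
Qed.

(** The Gaussian component makes the risk of the calibrated law quadratic in
    [s], while the risk of most samples is at most linear in [s]. *)
Lemma bias_correction_ge :
  ((alpha * eps ^+ 2 / 4 * s ^+ 2 -
    ((`|b| + spread) ^+ 2 / (alpha * eps ^+ 2) + spread + alpha^-1 * `|ln eps|))%:E
   <= bias_correction alpha N Q)%E.
Proof.
rewrite bias_correctionE; apply: (@median_ge _ _ _ _ _ [set y | close y]) => //.
move=> y /= cy; rewrite lee_fin gapE mulrBr.
have h1 : alpha^-1 * ln (avg y) <= spread * (s + 1).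
  apply: (@sample_risk_le _ _ alpha_gt0 _ (fun i => tnth y i - m)) => // i.
  by rewrite (le_trans (ler_norm _))// close_coord.
have as0 : 0 <= alpha * s by rewrite mulr_ge0// ltW.
have := mix_mgf_ge eps_gt0 as0 weight_ge mean_ge sdev_ge.
rewrite -ler_ln ?posrE ?mix_mgf_gt0 ?mulr_gt0 ?expR_gt0//.
rewrite lnM ?posrE ?expR_gt0// expRK => h2.
have h3 : alpha^-1 * ln eps + s * b + alpha * eps ^+ 2 / 2 * s ^+ 2 <=
    alpha^-1 * ln (M (alpha * s)).
  have -> : alpha^-1 * ln eps + s * b + alpha * eps ^+ 2 / 2 * s ^+ 2 =
    alpha^-1 * (ln eps + (alpha * s * b + (alpha * s * eps) ^+ 2 / 2)).
    by field; rewrite gt_eqF.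
  by rewrite ler_wpM2l// invr_ge0 ltW.
have h4 : - (alpha^-1 * `|ln eps|) <= alpha^-1 * ln eps.
  by rewrite -mulrN ler_wpM2l ?invr_ge0 ?(ltW alpha_gt0)// lerNl -normrN ler_norm.
have h5 : - (s * `|b|) <= s * b.
  by rewrite -mulrN ler_wpM2l// lerNl -normrN ler_norm.
have k0 : 0 < alpha * eps ^+ 2 by rewrite mulr_gt0// exprn_gt0.
(* Young's inequality absorbs the terms that are linear in s *)
have h6 : s * (`|b| + spread) <= alpha * eps ^+ 2 / 4 * s ^+ 2 +
    (`|b| + spread) ^+ 2 / (alpha * eps ^+ 2).
  move: (`|b| + spread) (alpha * eps ^+ 2) k0 => u k k0.
  rewrite -subr_ge0.
  have -> : k / 4 * s ^+ 2 + u ^+ 2 / k - s * u = (k * s / 2 - u) ^+ 2 / k.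
    by field; rewrite gt_eqF.
  by rewrite divr_ge0 ?sqr_ge0// ltW.
lra.
Qed.

(** The risk of most samples is at least the average of their values, which is
    not far below [m]. *)
Lemma bias_correction_le :
  (bias_correction alpha N Q <=
   ((B + alpha * B ^+ 2 / 2 + spread) * s ^+ 2 + (B + 2 * spread))%:E)%E.
Proof.
rewrite bias_correctionE; apply: (@median_le _ _ _ _ _ [set y | close y]) => //.
- rewrite -[X in measurable X]setTI.
  exact: emeasurable_fun_infty_c measurable_gap _.
- exact: ltW.
move=> y /= cy; rewrite lee_fin gapE mulrBr.
have h1 : - (spread * (s + 1)) <= alpha^-1 * ln (avg y).
  apply: le_trans (@sample_risk_ge_mean _ _ alpha_gt0 _ (fun i => tnth y i - m) N_gt0).
  rewrite ler_pdivlMl ?ltr0n// mulr_natl -[in leLHS](card_ord N) -sumr_const.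
  apply: ler_sum => i _.
  by rewrite lerNl (le_trans (ler_norm _))// normrN close_coord.
have := mix_mgf_le (alpha * s) sB mB.
rewrite -ler_ln ?posrE ?mix_mgf_gt0 ?expR_gt0// expRK.
rewrite ger0_norm ?mulr_ge0 ?(ltW alpha_gt0)// => h2.
have h3 : alpha^-1 * ln (M (alpha * s)) <= s * B + alpha * B ^+ 2 / 2 * s ^+ 2.
  have -> : s * B + alpha * B ^+ 2 / 2 * s ^+ 2 =
    alpha^-1 * (alpha * s * B + (alpha * s * B) ^+ 2 / 2).
    by field; rewrite gt_eqF.
  by rewrite ler_wpM2l// invr_ge0 ltW.
have B0 : 0 <= B by rewrite (le_trans _ (mB j0)).
have D0 := spread_ge0.
have h4 : s <= s ^+ 2 + 1 by nra.
have : 0 <= (B + spread) * (s ^+ 2 + 1 - s).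
  by apply: mulr_ge0; [exact: addr_ge0|rewrite subr_ge0].
lra.
Qed.

Let mexp_coord (i : 'I_N) :
  measurable_fun setT (fun y : N.-tuple R => expR (alpha * (tnth y i - m))).
Proof. by apply: (measurableT_comp (mexp alpha)); exact: measurable_tnth. Qed.

Let exp_sqr (x : R) : expR (alpha * (x - m)) ^+ 2 = expR (2 * alpha * (x - m)).
Proof. by rewrite expr2 -expRD; congr expR; ring. Qed.

Let L1_exp_sqr : L1 Q (fun x => expR (alpha * (x - m)) ^+ 2).
Proof.
have -> : (fun x : R => expR (alpha * (x - m)) ^+ 2) =
    (fun x => expR (2 * alpha * (x - m))) by apply/funext => x; rewrite exp_sqr.
exact: L1_exp.
Qed.

Let p := M (alpha * s).

Let mexp1 : measurable_fun setT (fun x : R => expR (alpha * (x - m))).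
Proof. exact: mexp. Qed.

Let L1_exp_var : L1 Q (fun x => (expR (alpha * (x - m)) - p) ^+ 2).
Proof. exact: L1_sqr_dev. Qed.

Let var_exp_le : \int[Q]_x ((expR (alpha * (x - m)) - p) ^+ 2) <= M (2 * alpha * s).
Proof.
have := mean_sqr_dev_le mexp1 L1_exp_sqr; rewrite mean_exp => /le_trans; apply.
by under eq_Rintegral do rewrite exp_sqr; rewrite mean_exp.
Qed.

(** The fraction is Chebyshev's bound on the probability that the exponential
    moment of N draws deviates by a factor [e] from its expectation; its numerator
    bounds the second moment, and [eps * expR (- (alpha * S * `|b|))] bounds the
    expectation from below, uniformly over [s <= S]. *)
Lemma bias_correction_small (S e : R) : 0 < e -> e <= 2^-1 -> s <= S ->
  expR (2 * alpha * S * B + (2 * alpha * S * B) ^+ 2 / 2) /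
    (N%:R * (e * (eps * expR (- (alpha * S * `|b|)))) ^+ 2) < 2^-1 ->
  (`|bias_correction alpha N Q| <= (2 * e / alpha)%:E)%E.
Proof.
move=> e0 e2 sS Nbig.
have p0 : 0 < p by exact: mix_mgf_gt0.
have as0 : 0 <= alpha * s by rewrite mulr_ge0// ltW.
have asS : alpha * s <= alpha * S by rewrite ler_wpM2l// ltW.
have B0 : 0 <= B by rewrite (le_trans _ (mB j0)).
pose p1 := eps * expR (- (alpha * S * `|b|)).
have p1_gt0 : 0 < p1 by rewrite mulr_gt0// expR_gt0.
have p1p : p1 <= p.
  apply: le_trans (mix_mgf_ge eps_gt0 as0 weight_ge mean_ge sdev_ge).
  rewrite ler_pM2l// ler_expR.
  apply: (@le_trans _ _ (alpha * s * b)).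
    rewrite lerNl -mulrN; apply: (@le_trans _ _ (alpha * s * `|b|)).
      by rewrite ler_wpM2l// -normrN ler_norm.
    by rewrite ler_wpM2r.
  by rewrite lerDl divr_ge0// sqr_ge0.
pose V2 := expR (2 * alpha * S * B + (2 * alpha * S * B) ^+ 2 / 2).
have MV : M (2 * alpha * s) <= V2.
  apply: le_trans (mix_mgf_le _ sB mB) _; rewrite ler_expR.
  have k0 : 0 <= 2 * alpha * s by rewrite -mulrA mulr_ge0.
  have kS : 2 * alpha * s * B <= 2 * alpha * S * B.
    by rewrite ler_wpM2r// -!mulrA ler_wpM2l.
  have kB0 : 0 <= 2 * alpha * s * B by rewrite mulr_ge0.
  rewrite ger0_norm// lerD// ler_wpM2r ?invr_ge0//.
  by rewrite ler_sqr ?nnegrE// (le_trans kB0).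
have wl := @weak_law _ _ _ (iid_law Q N) N
  (fun i y => expR (alpha * (tnth y i - m))) p
  (\int[Q]_x ((expR (alpha * (x - m)) - p) ^+ 2)) N_gt0 mexp_coord.
have L2 (i : 'I_N) := L1_law (mcoord i) (law_coord i) L1_exp_sqr.
have mean_i (i : 'I_N) := mean_law (mcoord i) (law_coord i) (L1_exp alpha).
have var_i (i : 'I_N) := mean_law (mcoord i) (law_coord i) L1_exp_var.
have {}wl := wl L2 (fun i => etrans (mean_i i) (mean_exp alpha)) var_i.
have ind (i j : 'I_N) : i != j -> pair_independent (iid_law Q N)
    (fun y => expR (alpha * (tnth y i - m))) (fun y => expR (alpha * (tnth y j - m))).
  move=> ij.
  exact: (pair_independent_comp (mexp alpha) (iid_law_independent Q ij)).
have ep0 : 0 < e * p by rewrite mulr_gt0.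
have {wl ind} wl := wl ind _ ep0.
pose far := [set y | e * p <= `|avg y - p|].
have mfar : measurable far.
  apply: measurable_superlevel; apply: measurableT_comp => //.
  exact: measurable_funB.
have q2 : (\int[Q]_x ((expR (alpha * (x - m)) - p) ^+ 2)) / (N%:R * (e * p) ^+ 2)
    < 2^-1.
  apply: le_lt_trans Nbig; rewrite -/p1 -/V2; apply: ler_pM.
  - by apply: Rintegral_ge0 => x _; exact: sqr_ge0.
  - by rewrite invr_ge0 mulr_ge0// sqr_ge0.
  - exact: le_trans var_exp_le MV.
  - have ep1 : 0 < e * p1 by exact: mulr_gt0.
    have le_den : N%:R * (e * p1) ^+ 2 <= N%:R * (e * p) ^+ 2.
      rewrite ler_wpM2l// ler_sqr ?nnegrE ?(ltW ep0) ?(ltW ep1)//.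
      by rewrite ler_wpM2l// ltW.
    have den_gt0 : 0 < N%:R * (e * p1) ^+ 2.
      by apply: mulr_gt0; [rewrite ltr0n|exact: exprn_gt0].
    by rewrite lef_pV2 ?posrE// (lt_le_trans den_gt0).
have half := half_lt_prob_compl mfar wl q2.
have gap_le y : (~` far) y -> `|gap y| <= 2 * e / alpha.
  move=> /negP; rewrite -ltNge => /(ln_close p0 e0 e2)[_ ln_le].
  rewrite gapE -/p normrM gtr0_norm ?invr_gt0// [leRHS]mulrC.
  by rewrite ler_wpM2l// invr_ge0 ltW.
have mcfar : measurable (~` far) by exact: measurableC.
rewrite bias_correctionE; apply: abse_le.
  apply: (@median_ge _ _ _ _ _ (~` far)) => // y /gap_le.
  by rewrite ler_norml => /andP[h _]; rewrite lee_fin.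
apply: (@median_le _ _ _ _ _ (~` far)) => //.
- rewrite -[X in measurable X]setTI.
  exact: emeasurable_fun_infty_c measurable_gap _.
- exact: ltW.
- by move=> y /gap_le; rewrite ler_norml => /andP[_ h]; rewrite lee_fin.
Qed.

End bias_of_affine_mixture.

(** * Measurability of the bias correction in the sample *)

Section kernels_of_probabilities.
Context d d' (X : measurableType d) (Y : measurableType d') (R : realType).

Definition kernel_family (k : X -> probability Y R) :=
  forall A, measurable A -> measurable_fun setT (fun x => k x A).

(** [kernel_family] states the measurability of a family of probabilities
    without bundling it; this gives access to the theory of kernels. *)
Definition packed_kernel (k : X -> probability Y R) (mk : kernel_family k)
  : X -> {measure set Y -> \bar R} := k.

Section packing.
Variables (k : X -> probability Y R) (mk : kernel_family k).

HB.instance Definition _ :=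
  @isKernel.Build _ _ X Y R (packed_kernel mk) mk.

Let packed_kernelT x : packed_kernel mk x [set: Y] = 1.
Proof. exact: (@probability_setT _ _ _ (k x)). Qed.

HB.instance Definition _ :=
  @Kernel_isProbability.Build _ _ X Y R (packed_kernel mk) packed_kernelT.

Lemma measurable_kernel_section (E : set (X * Y)) : measurable E ->
  measurable_fun setT (fun x => k x (xsection E x)).
Proof.
move=> mE.
exact: (measurable_fun_xsection_finite_kernel (packed_kernel mk) (mem_set mE)).
Qed.

Lemma measurable_kernel_integral (f : X * Y -> \bar R) :
  (forall z, 0 <= f z) -> measurable_fun setT f ->
  measurable_fun setT (fun x => \int[k x]_y f (x, y)).
Proof.
move=> f0 mf.
exact: (measurable_fun_integral_finite_kernel f (packed_kernel mk) f0 mf).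
Qed.

End packing.
End kernels_of_probabilities.

Section measurable_real_functions.
Local Open Scope ring_scope.
Context d (T : measurableType d) (R : realType).
Implicit Types f g : T -> R.

Lemma measurable_funV f : measurable_fun setT f ->
  measurable_fun setT (fun t => (f t)^-1).
Proof.
move=> mf.
(* the real inverse, through powers of the nonnegative number x ^+ 2 *)
have -> : (fun t => (f t)^-1) = (fun t => f t * (f t ^+ 2) `^ (- 1)).
  apply/funext => t; rewrite powR_inv1 ?sqr_ge0//.
  have [->|f0] := eqVneq (f t) 0; first by rewrite invr0 mul0r.
  by field.
apply: measurable_funM => //.
apply: (measurableT_comp (measurable_powR (- 1))).
exact: measurable_funX.
Qed.

Lemma measurable_fun_sqrt f : measurable_fun setT f ->
  measurable_fun setT (fun t => Num.sqrt (f t)).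
Proof.
move=> mf.
have -> : (fun t => Num.sqrt (f t)) = (fun t => (Num.max (f t) 0) `^ (2^-1)).
  apply/funext => t; rewrite powR12_sqrt ?le_max ?lexx ?orbT//.
  have [//|f0] := leP 0 (f t).
  by rewrite sqrtr0; apply/eqP; rewrite sqrtr_eq0 ltW.
apply: (measurableT_comp (measurable_powR (2^-1))).
exact: measurable_maxr.
Qed.

Lemma measurable_fun_div f g : measurable_fun setT f -> measurable_fun setT g ->
  measurable_fun setT (fun t => f t / g t).
Proof.
by move=> mf mg; apply: measurable_funM => //; exact: measurable_funV.
Qed.

End measurable_real_functions.

Section gaussian_kernel.
Local Open Scope ring_scope.
Context (R : realType).

Let pdf (z : (R * R) * measurableTypeR R) : R :=
  normal_peak z.1.2 * normal_fun z.1.1 z.1.2 z.2.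

Let measurable_pdf : measurable_fun setT pdf.
Proof.
have m1 : measurable_fun setT (fun z : (R * R) * measurableTypeR R => z.1.1).
  exact: measurableT_comp measurable_fst measurable_fst.
have m2 : measurable_fun setT (fun z : (R * R) * measurableTypeR R => z.1.2).
  exact: measurableT_comp measurable_snd measurable_fst.
have m3 : measurable_fun setT (fun z : (R * R) * measurableTypeR R => z.2 : R).
  exact: measurable_snd.
apply: measurable_funM.
  apply: measurable_funV; apply: measurable_fun_sqrt.
  have -> : (fun t : (R * R) * measurableTypeR R => t.1.2 ^+ 2 * pi *+ 2) =
      (fun t => t.1.2 ^+ 2 * (pi *+ 2)) by apply/funext => t; exact: esym (mulrnAr _ _ _).
  by apply: measurable_funM => //; exact: measurable_funX.
apply: measurableT_comp => //; apply: measurable_fun_div.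
  apply: measurableT_comp => //; apply: measurable_funX.
  exact: measurable_funB.
have -> : (fun t : (R * R) * measurableTypeR R => t.1.2 ^+ 2 *+ 2) =
    (fun t => t.1.2 ^+ 2 * 2) by apply/funext => t; rewrite mulr_natr.
by apply: measurable_funM => //; exact: measurable_funX.
Qed.

(** Off [s = 0] the probability is an integral of the density, which is jointly
    measurable in the mean, the standard deviation and the point. *)
Lemma kernel_gauss : kernel_family (fun p : R * R => gauss p.1 p.2).
Proof.
move=> A mA.
pose g (p : R * R) := (\int[lebesgue_measure]_x (pdf (p, x) * \1_A x)%:E)%E.
pose h (z : (R * R) * measurableTypeR R) : \bar R := (pdf z * \1_A z.2)%:E.
have mh : measurable_fun setT h.
  apply/measurable_EFinP; apply: measurable_funM => //.
  have mI : measurable_fun setT (\1_A : measurableTypeR R -> R).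
    exact: measurable_indic.
  exact: (measurableT_comp mI measurable_snd).
have h0 z : (0 <= h z)%E.
  by rewrite lee_fin mulr_ge0// mulr_ge0 ?normal_peak_ge0 ?normal_fun_ge0.
have mg : measurable_fun setT g.
  exact: (measurable_fun_fubini_tonelli_F (m2 := lebesgue_measure) h mh h0).
rewrite (_ : (fun p => _) =
    (fun p : R * R => if p.2 == 0 then (\1_A p.1)%:E else g p)); last first.
  apply/funext => -[m s] /=; rewrite /gauss; case: ifPn => //= s0.
  rewrite /normal_prob integral_mkcond; apply: eq_integral => x _.
  rewrite patchE /pdf /= indicE normal_pdfE//.
  by case: (x \in A); rewrite ?mulr1 ?mulr0.
apply: measurable_fun_ifT => //.
  by apply: measurable_fun_eqr => //; exact: measurable_snd.
apply/measurable_EFinP; apply: (measurableT_comp _ measurable_fst).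
exact: measurable_indic.
Qed.

End gaussian_kernel.

Section composed_kernels.
Context (R : realType).

Lemma kernel_gmm d (X : measurableType d) J (theta : X -> gmm_param R J) :
  measurable_fun setT (fun x => weights (theta x)) ->
  measurable_fun setT (fun x => means (theta x)) ->
  measurable_fun setT (fun x => sdevs (theta x)) ->
  kernel_family (fun x => gmm (theta x)).
Proof.
move=> mw mm ms A mA; rewrite /= /gmm.
apply: emeasurable_sum => j; apply: emeasurable_funM.
  apply/measurable_EFinP; exact: (measurableT_comp (measurable_tnth j) mw).
pose ps x := (tnth (means (theta x)) j, tnth (sdevs (theta x)) j).
have mps : measurable_fun setT ps.
  apply/measurable_fun_pairP; split.
    exact: (measurableT_comp (measurable_tnth j) mm).
  exact: (measurableT_comp (measurable_tnth j) ms).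
exact: (measurableT_comp (kernel_gauss mA) mps).
Qed.

Lemma kernel_affine d (X : measurableType d) (k : X -> probability R R)
    (m s : X -> R) : measurable_fun setT m -> measurable_fun setT s ->
  kernel_family k ->
  kernel_family (fun x => distribution (k x) (affine (m x) (s x)) : probability R R).
Proof.
move=> mm ms mk A mA.
pose g (z : X * R) : R := affine (m z.1) (s z.1) z.2.
have mg : measurable_fun setT g.
  apply: measurable_funD; first exact: measurableT_comp.
  by apply: measurable_funM => //; exact: measurableT_comp.
have mE : measurable (g @^-1` A).
  by rewrite -[X in measurable X]setTI; exact: mg.
rewrite (_ : (fun x => _) = (fun x => k x (xsection (g @^-1` A) x))).
  exact: measurable_kernel_section.
by apply/funext => x /=; rewrite /distribution /pushforward xsectionE.
Qed.

(** The section of an event at its first draw [r] has a probability that is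
    jointly measurable in the parameter and in [r], which is what integrating
    over [r] requires. *)
Lemma kernel_iid_law d (X : measurableType d) (k : X -> probability R R) n :
  kernel_family k -> kernel_family (fun x => iid_law (k x) n).
Proof.
move=> mk; elim: n => [|n IH] A mA.
  exact: measurable_cst.
pose B := @tuple_cons R n @^-1` A.
have mB : measurable B.
  by rewrite -[X in measurable X]setTI; exact: measurable_tuple_cons.
pose k' (z : X * R) : probability (n.-tuple R) R := iid_law (k z.1) n.
have mk' : kernel_family k'.
  by move=> C mC; exact: (measurableT_comp (IH C mC) measurable_fst).
pose E : set ((X * R) * n.-tuple R) := (fun z => (z.1.2, z.2)) @^-1` B.
have mE : measurable E.
  have mf : measurable_fun setT (fun z : (X * R) * n.-tuple R => (z.1.2, z.2)).
    apply/measurable_fun_pairP; split; last exact: measurable_snd.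
    exact: measurableT_comp measurable_snd measurable_fst.
  by rewrite -[X in measurable X]setTI; exact: mf.
have mg := measurable_kernel_section mk' mE.
rewrite (_ : (fun x => _) = (fun x => \int[k x]_r k' (x, r) (xsection E (x, r)))).
  exact: (measurable_kernel_integral mk (f := fun z => k' z (xsection E z))).
apply/funext => x; rewrite /= /distribution /pushforward /product_measure1.
by apply: eq_integral => r _; rewrite /= !xsectionE.
Qed.

(** The median lies below [r] if and only if, for some rational [q < r], the
    value [q] is exceeded with probability at most one half. *)
Lemma measurable_median d d' (X : measurableType d) (Y : measurableType d')
    (k : X -> probability Y R) (f : X * Y -> \bar R) :
  kernel_family k -> measurable_fun setT f ->
  measurable_fun setT (fun x => median (k x) (fun y => f (x, y))).
Proof.
move=> mk mf; apply: (measurability _ (ErealGenInftyO.measurableE R)).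
move=> _ /= [_ [r ->] <-]; rewrite setTI.
pose E (q : \bar R) := [set z | f z <= q].
have mE q : measurable (E q).
  by rewrite -[X in measurable X]setTI; exact: emeasurable_fun_infty_c.
pose half (q : R) := [set x | (2^-1)%:E <= k x (xsection (E q%:E) x)].
have mhalf q : measurable (half q).
  rewrite -[X in measurable X]setTI.
  exact: emeasurable_fun_c_infty (measurable_kernel_section mk (mE q%:E)) _.
have sectionE q x : xsection (E q) x = [set y | f (x, y) <= q].
  by rewrite xsectionE.
rewrite (_ : _ @^-1` _ = \bigcup_(q : rat) (if (ratr q < r)%R then half (ratr q) else set0)).
  by apply: bigcupT_measurable_rat => q; case: ifP.
apply/seteqP; split => x /=.
  rewrite in_itv/= => /ereal_inf_lt[m /= Pm mr].
  have [c mc cr] : exists2 c : R, m <= c%:E & (c < r)%R.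
    case: m {Pm} mr => [c cr|//|_]; first by exists c.
    by exists (r - 1)%R; rewrite ?leNye// ltrBlDr ltrDl.
  have [q] := rat_in_itvoo cr; rewrite in_itv/= => /andP[cq qr].
  have mq : m <= (ratr q)%:E by rewrite (le_trans mc)// lee_fin ltW.
  exists q => //; rewrite qr /half /= sectionE (le_trans Pm)//.
  apply: le_measure; rewrite ?inE.
  - by rewrite -sectionE; exact: measurable_xsection.
  - by rewrite -sectionE; exact: measurable_xsection.
  - by move=> y /= /le_trans; apply.
move=> [q _]; case: ifPn => // qr; rewrite /half/= sectionE => Pq.
rewrite in_itv/=; apply: le_lt_trans (_ : (ratr q)%:E < r%:E); last by rewrite lte_fin.
exact: ereal_inf_lbound.
Qed.

End composed_kernels.

Section measurability_of_the_bias_correction.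
Local Open Scope ring_scope.
Context (R : realType) (N : nat).

Lemma measurable_smean : measurable_fun setT (@smean R N).
Proof.
by apply: measurable_funM => //; apply: measurable_sum => i; exact: measurable_tnth.
Qed.

Lemma measurable_ssdev : measurable_fun setT (@ssdev R N).
Proof.
apply: measurable_fun_sqrt; apply: measurable_funM => //.
apply: measurable_sum => i; apply: measurable_funX.
by apply: measurable_funB; [exact: measurable_tnth|exact: measurable_smean].
Qed.

Lemma measurable_standardize : measurable_fun setT (@standardize R N).
Proof.
apply/measurable_fun_tnthP => i.
rewrite (_ : _ \o _ = fun x : N.-tuple R => (tnth x i - smean x) / ssdev x).
  apply: measurable_fun_div; last exact: measurable_ssdev.
  by apply: measurable_funB; [exact: measurable_tnth|exact: measurable_smean].
by apply/funext => x; rewrite /= tnth_mktuple.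
Qed.

Variables (alpha : R) (J : nat) (Theta : set (gmm_param R J)).
Variable fit : forall N, N.-tuple R -> gmm_param R J.
Hypothesis fit_rule : fitting_rule Theta fit.
Variables (eps : R) (j0 : 'I_J).
Hypothesis eps_gt0 : 0 < eps.
Hypothesis weight_ge : forall theta, Theta theta -> eps <= tnth (weights theta) j0.
Hypothesis N_gt0 : (0 < N)%N.

Let theta (x : N.-tuple R) := fit (standardize x).

Let mweights : measurable_fun setT (fun x => weights (theta x)).
Proof.
have [_ mw _ _] := fit_rule N; exact: measurableT_comp mw measurable_standardize.
Qed.

Let mmeans : measurable_fun setT (fun x => means (theta x)).
Proof.
have [_ _ mm _] := fit_rule N; exact: measurableT_comp mm measurable_standardize.
Qed.

Let msdevs : measurable_fun setT (fun x => sdevs (theta x)).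
Proof.
have [_ _ _ ms] := fit_rule N; exact: measurableT_comp ms measurable_standardize.
Qed.

Lemma kernel_calibrate : kernel_family (@calibrate R J fit N).
Proof.
apply: (kernel_affine (k := fun x => gmm (theta x))).
- exact: measurable_smean.
- exact: measurable_ssdev.
- exact: kernel_gmm.
Qed.

Let mtnth (f : N.-tuple R -> J.-tuple R) j : measurable_fun setT f ->
  measurable_fun setT (fun x => tnth (f x) j).
Proof. by move=> mf; exact: (measurableT_comp (measurable_tnth j) mf). Qed.

Let mmgf : measurable_fun setT (fun x => mix_mgf (theta x) (alpha * ssdev x)).
Proof.
have mas : measurable_fun setT (fun x : N.-tuple R => alpha * ssdev x).
  by apply: measurable_funM => //; exact: measurable_ssdev.
apply: measurable_sum => j; apply: measurable_funM; first exact: mtnth.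
apply: measurableT_comp => //; apply: measurable_funD.
  by apply: measurable_funM => //; exact: mtnth.
apply: measurable_funM => //; apply: measurable_funX.
by apply: measurable_funM => //; exact: mtnth.
Qed.

Lemma measurable_bias_correction :
  measurable_fun setT (fun x : N.-tuple R => bias_correction alpha N (calibrate fit x)).
Proof.
pose f (z : N.-tuple R * N.-tuple R) :=
  (risk_gap alpha (theta z.1) (smean z.1) (ssdev z.1) z.2)%:E.
rewrite (_ : (fun x => _) =
    (fun x => median (iid_law (calibrate fit x) N) (fun y => f (x, y)))).
  apply: (measurable_median (k := fun x => iid_law (calibrate fit x) N)).
    by apply: kernel_iid_law; exact: kernel_calibrate.
  apply/measurable_EFinP; apply: measurable_funM => //; apply: measurable_funB.
    apply: measurableT_comp; first exact: measurable_ln.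
    exact: measurableT_comp mmgf measurable_fst.
  apply: measurableT_comp; first exact: measurable_ln.
  apply: measurable_funM => //; apply: measurable_sum => i.
  apply: measurableT_comp => //; apply: measurable_funM => //.
  apply: measurable_funB.
    exact: measurableT_comp (measurable_tnth i) measurable_snd.
  exact: measurableT_comp measurable_smean measurable_fst.
apply/funext => x.
have Th : Theta (theta x) by have [/(_ (standardize x))[]] := fit_rule N.
exact: (bias_correctionE alpha eps_gt0 (weight_ge Th)).
Qed.

End measurability_of_the_bias_correction.

(** * Exponential moments of light-tailed variables *)

Section light_tails.
Local Open Scope ring_scope.
Context d (T : measurableType d) (R : realType) (P : probability T R).
Variables (X : T -> R).
Hypothesis mX : measurable_fun setT X.

(** Summability of [expR (kappa * (k + 1) ^ 2 - C * k ^ q)] over k, with an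
    exponential rate. *)
Lemma powR_beats_square (q C kappa : R) : 2 < q -> 0 < C -> 0 <= kappa ->
  exists K, forall x, 0 <= x -> kappa * (x + 1) ^+ 2 - C * x `^ q <= K - x.
Proof.
move=> q2 C0 k0.
pose A := (4 * kappa + 1) / C.
have A0 : 0 < A by rewrite divr_gt0// ltr_wpDl// mulr_ge0.
pose x0 := Num.max 1 (A `^ (q - 2)^-1).
have x01 : 1 <= x0 by rewrite le_max lexx.
exists (kappa * (x0 + 1) ^+ 2 + x0) => x xge0.
have [xx0|x0x] := leP x x0.
  have := powR_ge0 x q => xq.
  have h1 : kappa * (x + 1) ^+ 2 <= kappa * (x0 + 1) ^+ 2.
    by rewrite ler_wpM2l// ler_sqr ?nnegrE ?addr_ge0 ?lerD2r// (le_trans ler01).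
  have h2 : 0 <= C * x `^ q by rewrite mulr_ge0// ltW.
  lra.
have x1 : 1 <= x by rewrite (le_trans x01)// ltW.
have xgt0 : 0 < x by rewrite (lt_le_trans ltr01).
have Ax : A <= x `^ (q - 2).
  have q20 : 0 < q - 2 by rewrite subr_gt0.
  have -> : A = (A `^ (q - 2)^-1) `^ (q - 2).
    by rewrite -powRrM mulVf ?gt_eqF// powRr1// ltW.
  apply: ge0_ler_powR; rewrite ?nnegrE ?powR_ge0// ?ltW//.
  by rewrite (le_lt_trans _ x0x)// le_max lexx orbT.
have xq : x `^ q = x `^ (q - 2) * x ^+ 2.
  rewrite -powR_mulrn// -powRD; last by rewrite (gt_eqF xgt0) implybT.
  by congr (_ `^ _); rewrite subrK.
have h : (4 * kappa + 1) * x ^+ 2 <= C * x `^ q.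
  rewrite xq mulrA ler_wpM2r ?sqr_ge0//.
  by rewrite -ler_pdivrMl// mulrC.
have h3 : 0 <= kappa * (x0 + 1) ^+ 2 + x0.
  by apply: addr_ge0; [rewrite mulr_ge0 ?sqr_ge0|exact: le_trans ler01 x01].
have h4 : x <= x ^+ 2 by rewrite expr2 ler_peMl.
have h5 : kappa * (x + 1) ^+ 2 <= kappa * (4 * x ^+ 2).
  by rewrite ler_wpM2l//; nra.
nra.
Qed.

Let mtail (a : R) : measurable [set t | a <= `|X t|].
Proof. by apply: measurable_superlevel; exact: measurableT_comp. Qed.

(** With k the integer part of [`|X t|], the integrand is at most
    [expR (kappa * (k + 1) ^ 2)]; the events [k <= `|X|] have summable
    contributions. *)
Lemma light_tail_L1 (kappa : R) : lighter_than_gaussian P X -> 0 <= kappa ->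
  L1 P (fun t => expR (kappa * X t ^+ 2)).
Proof.
move=> [q [G [C [q2 G0 C0 tail]]]] k0.
have [K HK] := powR_beats_square q2 C0 k0.
have mexp : measurable_fun setT (fun t => expR (kappa * X t ^+ 2)).
  apply: measurableT_comp => //; apply: measurable_funM => //.
  exact: measurable_funX.
pose u (k : nat) (t : T) : \bar R :=
  (expR (kappa * (k%:R + 1) ^+ 2) * \1_[set t | k%:R <= `|X t|] t)%:E.
have mu k : measurable_fun setT (u k).
  by apply/measurable_EFinP; apply: measurable_funM.
have u0 k t : (0 <= u k t)%E by rewrite lee_fin mulr_ge0// expR_ge0.
have le_u t : ((expR (kappa * X t ^+ 2))%:E <= \sum_(k <oo) u k t)%E.
  pose k := Num.truncn `|X t|.
  have /andP[kX Xk] := truncn_itv (normr_ge0 (X t)).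
  apply: (@le_trans _ _ (u k t)); last first.
    rewrite (@nneseriesD1 _ _ k xpredT)//.
    by rewrite leeDl// nneseries_ge0.
  rewrite /u lee_fin indicE mem_set// mulr1 ler_expR ler_wpM2l//.
  rewrite -(real_normK (num_real (X t))) ler_sqr ?nnegrE ?addr_ge0//.
  by rewrite -natr1 in Xk; exact: ltW.
have int_u k : (\int[P]_t u k t <= (G * expR (K + 1) / (2 ^ k.+1)%:R)%:E)%E.
  have -> : (\int[P]_t u k t =
      (expR (kappa * (k%:R + 1) ^+ 2))%:E * P [set t | (k%:R <= `|X t|)%R])%E.
    rewrite /u; under eq_integral do rewrite EFinM.
    rewrite ge0_integralZl//; first by rewrite integral_indic// setIT.
    by apply/measurable_EFinP; apply: measurable_indic.
  apply: (@le_trans _ _ ((expR (kappa * (k%:R + 1) ^+ 2))%:E *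
      (G * expR (- C * k%:R `^ q))%:E)%E).
    by rewrite lee_wpmul2l ?lee_fin ?expR_ge0// tail.
  rewrite -EFinM lee_fin mulrCA -expRD -mulrA ler_pM2l//.
  apply: (@le_trans _ _ (expR (K - k%:R))).
    by rewrite ler_expR mulNr HK.
  rewrite natrX ler_pdivlMr ?exprn_gt0//.
  (* the exponential rate is weakened to powers of 2, as 2 <= e *)
  have h : 2 ^+ k.+1 <= expR (k%:R + 1) :> R.
    rewrite natr1 -[X in expR X]mulr1 expRM_natl.
    by rewrite lerXn2r ?nnegrE ?expR_ge0//; have := @expR_ge1Dx R 1; lra.
  apply: le_trans (ler_wpM2l (expR_ge0 _) h) _.
  by rewrite -expRD ler_expR; lra.
apply: (@ge0_L1 _ _ _ _ _ (G * expR (K + 1))%:E) => //; last exact: ltry.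
apply: (@le_trans _ _ (\int[P]_t (\sum_(k <oo) u k t))%E).
  exact: le_integral_any.
rewrite integral_nneseries//.
apply: (@le_trans _ _ (\sum_(k <oo) (G * expR (K + 1) / (2 ^ k.+1)%:R)%:E)%E).
  apply: lee_nneseries => [k _ _|k _]; last exact: int_u.
  by apply: integral_ge0 => t _; exact: u0.
(* the geometric series of ratio 1 / 2 *)
apply: epsilon_trick0.
by rewrite mulr_ge0 ?expR_ge0// ltW.
Qed.

Hypothesis light : lighter_than_gaussian P X.

Lemma light_tail_expR_L1 (k : R) : L1 P (fun t => expR (k * X t)).
Proof.
apply: (@L1_le _ _ _ P _ (fun t => expR (k ^+ 2) * expR (1 * X t ^+ 2))).
- by apply: measurableT_comp => //; exact: measurable_funM.
- move=> t; rewrite ger0_norm ?expR_ge0// -expRD ler_expR mul1r.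
  by have := sqr_ge0 (k - X t); have := sqr_ge0 (k + X t); nra.
- by apply: L1Z; exact: light_tail_L1.
Qed.

Lemma light_tail_sqr_L1 : L1 P (fun t => X t ^+ 2).
Proof.
apply: (@L1_le _ _ _ P _ (fun t => expR (1 * X t ^+ 2))).
- exact: measurable_funX.
- move=> t; rewrite ger0_norm ?sqr_ge0// mul1r.
  by have := @expR_ge1Dx R (X t ^+ 2); lra.
- exact: light_tail_L1.
Qed.

End light_tails.

(** * Moments of the sampled losses *)

Section exponential_moments.
Local Open Scope ring_scope.
Context d (T : measurableType d) (R : realType) (P : probability T R).

(** Jensen's inequality, by integrating the tangent line of the exponential at
    the mean. *)
Lemma jensen_expR (k : R) (X : T -> R) : L1 P X -> L1 P (fun t => expR (k * X t)) ->
  expR (k * \int[P]_t X t) <= \int[P]_t expR (k * X t).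
Proof.
move=> LX LE; set m := \int[P]_t X t.
have LXm : L1 P (fun t => k * (X t - m)).
  by apply: L1Z; apply: L1B => //; exact: L1_cst.
have <- : \int[P]_t (expR (k * m) * (1 + k * (X t - m))) = expR (k * m).
  rewrite meanZ; last by apply: L1D => //; exact: L1_cst.
  rewrite meanD//; last exact: L1_cst.
  rewrite meanZ; last by apply: L1B => //; exact: L1_cst.
  rewrite meanB//; last exact: L1_cst.
  by rewrite !mean_cst subrr mulr0 addr0 mulr1.
apply: le_mean => //.
  by apply: L1Z; apply: L1D => //; exact: L1_cst.
move=> t; have -> : k * X t = k * m + k * (X t - m) by ring.
by rewrite expRD ler_wpM2l ?expR_ge0// expR_ge1Dx.
Qed.

End exponential_moments.

Section dispersion_of_a_sample.
Local Open Scope ring_scope.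
Context (R : realType) (N : nat).
Hypothesis N_gt0 : (0 < N)%N.
Implicit Types x : N.-tuple R.

Let NR0 : (N%:R : R) != 0. Proof. by rewrite pnatr_eq0 -lt0n. Qed.

Lemma ssdev_ge0 x : 0 <= ssdev x. Proof. exact: sqrtr_ge0. Qed.

Lemma ssdev_sqr x : ssdev x ^+ 2 = N%:R^-1 * \sum_i (tnth x i - smean x) ^+ 2.
Proof.
rewrite sqr_sqrtr// mulr_ge0 ?invr_ge0//.
by apply: sumr_ge0 => i _; exact: sqr_ge0.
Qed.

(** Centring at any constant [m], which will be the true mean, separates the
    squared deviations into two terms with known expectations. *)
Lemma ssdev_sqrE x (m : R) : ssdev x ^+ 2 =
  N%:R^-1 * \sum_i (tnth x i - m) ^+ 2 - (smean x - m) ^+ 2.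
Proof.
rewrite ssdev_sqr.
have E i : (tnth x i - smean x) ^+ 2 = (tnth x i - m) ^+ 2 +
    ((- 2 * (smean x - m)) * tnth x i + (smean x ^+ 2 - m ^+ 2)) by ring.
rewrite (eq_bigr _ (fun i _ => E i)) big_split/= big_split/= -mulr_sumr.
rewrite sumr_const card_ord -[_ *+ N]mulr_natl.
have -> : \sum_i tnth x i = N%:R * smean x by rewrite /smean mulVKf.
by field.
Qed.

(** Crude, but quadratic in the standard deviation, which is the order that
    matters. *)
Lemma coord_le_smean x i : tnth x i <= smean x + (N%:R * ssdev x ^+ 2 + 1).
Proof.
have h : (tnth x i - smean x) ^+ 2 <= N%:R * ssdev x ^+ 2.
  rewrite ssdev_sqr mulVKf// (bigD1 i)//= lerDl.
  by apply: sumr_ge0 => k _; exact: sqr_ge0.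
have : tnth x i - smean x <= (tnth x i - smean x) ^+ 2 + 1.
  by move: (tnth x i - smean x) => a; have := sqr_ge0 (a - 1); have := sqr_ge0 a; nra.
lra.
Qed.

End dispersion_of_a_sample.

Section sampled_losses.
Local Open Scope ring_scope.
Context (R : realType) (M : model R) (z : 'rV[R]_(zdim M)).
Hypothesis zM : decisions M z.
Hypothesis light : lighter_than_gaussian (law M) (loss M z).

Let L := loss M z.

Let mL : measurable_fun setT L. Proof. exact: loss_measurable. Qed.

Definition loss_mean := \int[law M]_t L t.
Definition loss_var := \int[law M]_t ((L t - loss_mean) ^+ 2).
Local Notation m := loss_mean.
Local Notation v := loss_var.

Lemma L1_loss_sqr : L1 (law M) (fun t => L t ^+ 2).
Proof. exact: light_tail_sqr_L1. Qed.

Lemma L1_loss : L1 (law M) L.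
Proof. exact: L1_sqr L1_loss_sqr. Qed.

Lemma L1_loss_expR k : L1 (law M) (fun t => expR (k * L t)).
Proof. exact: light_tail_expR_L1. Qed.

Lemma L1_loss_dev : L1 (law M) (fun t => (L t - m) ^+ 2).
Proof. exact: L1_sqr_dev mL L1_loss_sqr. Qed.

Lemma loss_var_ge0 : 0 <= v.
Proof. by apply: Rintegral_ge0 => t _; exact: sqr_ge0. Qed.

Lemma loss_varianceE : loss_variance z = v%:E.
Proof.
rewrite /loss_variance /variance unlock.
have -> : fine 'E_(law M)[loss M z] = m by rewrite unlock.
rewrite unlock -EFin_mean; last exact: L1_loss_dev.
by apply: eq_integral => t _; rewrite expr2.
Qed.

Lemma loss_sdevE : loss_sdev z = (Num.sqrt v)%:E.
Proof. by rewrite /loss_sdev loss_varianceE poweR_EFin powR12_sqrt// loss_var_ge0. Qed.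

Lemma true_riskE (alpha : R) :
  true_risk alpha z = (alpha^-1 * ln (\int[law M]_t expR (alpha * L t)))%:E.
Proof.
have LE := L1_loss_expR alpha.
apply: entropic_riskE; last exact: EFin_mean.
exact: lt_le_trans (expR_gt0 _) (jensen_expR L1_loss LE).
Qed.

Lemma true_risk_ge_mean (alpha : R) : 0 < alpha ->
  m <= alpha^-1 * ln (\int[law M]_t expR (alpha * L t)).
Proof.
move=> a0; have := jensen_expR L1_loss (L1_loss_expR alpha).
rewrite ler_pdivlMl// => h; rewrite -[leLHS]expRK ler_ln ?posrE ?expR_gt0//.
exact: lt_le_trans (expR_gt0 _) h.
Qed.

Let Y i w := L (sample M i w).

Let msample i : measurable_fun setT (sample M i).
Proof. exact: sample_measurable. Qed.

Lemma measurable_sampled_loss i : measurable_fun setT (Y i).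
Proof. exact: measurableT_comp. Qed.

Let law_sample i A : measurable A -> Pr M (sample M i @^-1` A) = law M A.
Proof. by move=> mA; exact: (sample_law i). Qed.

Lemma L1_sampled i (f : R -> R) : L1 (law M) (f \o L) -> L1 (Pr M) (fun w => f (Y i w)).
Proof. by move=> Lf; exact: (L1_law (msample i) (@law_sample i) Lf). Qed.

Lemma mean_sampled i (f : R -> R) : L1 (law M) (f \o L) ->
  \int[Pr M]_w f (Y i w) = \int[law M]_t f (L t).
Proof. by move=> Lf; exact: (mean_law (msample i) (@law_sample i) Lf). Qed.

Lemma sampled_independent i j : i != j -> pair_independent (Pr M) (Y i) (Y j).
Proof.
move=> ij; apply: (pair_independent_comp mL) => A B mA mB.
have ji : (j == i) = false by rewrite eq_sym (negbTE ij).
pose F k := if k == i then A else B.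
have u : uniq [:: i; j] by rewrite /= inE ij.
have mF k : measurable (F k) by rewrite /F; case: ifP.
have := sample_independent u mF.
rewrite !big_cons big_nil mule1 /F eqxx ji => <-; congr (Pr M _).
apply/seteqP; split => w /=.
  by move=> [Aw Bw] k /=; rewrite !inE => /orP[]/eqP ->; rewrite ?eqxx ?ji.
move=> h; split.
  by have := h i; rewrite /= !inE eqxx /= => /(_ isT).
by have := h j; rewrite /= !inE eqxx orbT ji /= => /(_ isT).
Qed.

Variable N : nat.
Hypothesis N_gt0 : (0 < N)%N.

Lemma tnth_scenarios w (i : 'I_N) : tnth (scenarios z N w) i = Y i w.
Proof. by rewrite /scenarios tnth_mktuple. Qed.

Lemma measurable_scenarios : measurable_fun setT (@scenarios R M z N).
Proof.
apply/measurable_fun_tnthP => i.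
rewrite (_ : _ \o _ = Y i); first exact: measurable_sampled_loss.
by apply/funext => w; rewrite /= tnth_scenarios.
Qed.

Lemma smean_scenarios w : smean (scenarios z N w) = N%:R^-1 * \sum_(i < N) Y i w.
Proof. by congr (_ * _); apply: eq_bigr => i _; rewrite tnth_scenarios. Qed.

Let L1Y2 (i : 'I_N) : L1 (Pr M) (fun w => Y i w ^+ 2).
Proof. exact: (L1_sampled i (f := fun x => x ^+ 2) L1_loss_sqr). Qed.
Let mYi (i : 'I_N) : measurable_fun setT (Y i).
Proof. exact: measurable_sampled_loss. Qed.
Let L1Y (i : 'I_N) : L1 (Pr M) (Y i). Proof. exact: L1_sqr. Qed.
Let meanY (i : 'I_N) : \int[Pr M]_w Y i w = m.
Proof. exact: (mean_sampled i (f := id) L1_loss). Qed.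
Let L1Yvar (i : 'I_N) : L1 (Pr M) (fun w => (Y i w - m) ^+ 2).
Proof. exact: (L1_sampled i (f := fun x => (x - m) ^+ 2) L1_loss_dev). Qed.
Let varY (i : 'I_N) : \int[Pr M]_w ((Y i w - m) ^+ 2) = v.
Proof. exact: (mean_sampled i (f := fun x => (x - m) ^+ 2) L1_loss_dev). Qed.
Let indY (i j : 'I_N) : i != j -> pair_independent (Pr M) (Y i) (Y j).
Proof. by move=> ij; exact: sampled_independent. Qed.

Lemma L1_smean : L1 (Pr M) (fun w => smean (scenarios z N w)).
Proof.
rewrite (_ : (fun w => _) = (fun w => N%:R^-1 * \sum_(i < N) Y i w)).
  by apply: L1Z; exact: L1_sum.
by apply/funext => w; exact: smean_scenarios.
Qed.

Lemma mean_smean : \int[Pr M]_w smean (scenarios z N w) = m.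
Proof.
under eq_Rintegral do rewrite smean_scenarios.
exact: mean_avg.
Qed.

Let ssdevE w : ssdev (scenarios z N w) ^+ 2 =
  N%:R^-1 * \sum_(i < N) (Y i w - m) ^+ 2 - (N%:R^-1 * \sum_(i < N) Y i w - m) ^+ 2.
Proof.
rewrite (ssdev_sqrE N_gt0 _ m) smean_scenarios; congr (_ * _ - _).
by apply: eq_bigr => i _; rewrite tnth_scenarios.
Qed.

Let L1_sumdev : L1 (Pr M) (fun w => N%:R^-1 * \sum_(i < N) (Y i w - m) ^+ 2).
Proof. by apply: L1Z; exact: L1_sum. Qed.

Let L1_meandev : L1 (Pr M) (fun w => (N%:R^-1 * \sum_(i < N) Y i w - m) ^+ 2).
Proof. exact: L1_avg_sq. Qed.

Lemma L1_ssdev_sqr : L1 (Pr M) (fun w => ssdev (scenarios z N w) ^+ 2).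
Proof.
rewrite (_ : (fun w => _) = (fun w => N%:R^-1 * \sum_(i < N) (Y i w - m) ^+ 2 -
    (N%:R^-1 * \sum_(i < N) Y i w - m) ^+ 2)); first exact: L1B.
by apply/funext => w; exact: ssdevE.
Qed.

Lemma mean_ssdev_sqr :
  \int[Pr M]_w (ssdev (scenarios z N w) ^+ 2) = v * (1 - N%:R^-1).
Proof.
under eq_Rintegral do rewrite ssdevE.
rewrite meanB// meanZ; last exact: L1_sum.
rewrite mean_sum// (eq_bigr (fun=> v)) => [|i _]; last exact: varY.
rewrite sumr_const card_ord -[v *+ N]mulr_natl mulKf ?pnatr_eq0 -?lt0n//.
by rewrite (mean_avg_sq N_gt0 mYi L1Y2 meanY varY indY); ring.
Qed.

End sampled_losses.

(** * The estimator and its expectation *)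

Section estimator_bounds.
Local Open Scope ring_scope.
Context (R : realType) (alpha : R) (J : nat) (Theta : set (gmm_param R J)).
Variable fit : forall N, N.-tuple R -> gmm_param R J.
Variables (B eps b : R) (j0 : 'I_J).
Hypothesis alpha_gt0 : 0 < alpha.
Hypothesis Theta_bounded : forall theta, Theta theta ->
  (forall j, tnth (sdevs theta) j <= B) /\ (forall j, `|tnth (means theta) j| <= B).
Hypothesis eps_gt0 : 0 < eps.
Hypothesis Theta_nondegenerate : forall theta, Theta theta ->
  [/\ eps <= tnth (weights theta) j0, b <= tnth (means theta) j0 &
      eps <= tnth (sdevs theta) j0].
Hypothesis fit_rule : fitting_rule Theta fit.

Lemma fitted_in_Theta N (x : N.-tuple R) : Theta (fit x).
Proof. by have [/(_ x)[]] := fit_rule N. Qed.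

(** The estimator minus the mean of the scenarios is between
    [lower_slope * s ^ 2 - lower_const] and [upper_slope * s ^ 2 + upper_const],
    with s their standard deviation. *)
Definition lower_slope := alpha * eps ^+ 2 / 4.
Definition lower_const N := (`|b| + spread B N) ^+ 2 / (alpha * eps ^+ 2) +
  spread B N + alpha^-1 * `|ln eps|.
Definition upper_slope N := B + alpha * B ^+ 2 / 2 + spread B N + N%:R.
Definition upper_const N := B + 2 * spread B N + 1.

Lemma bound_ge0 : 0 <= B.
Proof.
have [_ /(_ j0) mB] := Theta_bounded (fitted_in_Theta [tuple of nseq 0 0]).
exact: le_trans mB.
Qed.

Lemma lower_slope_gt0 : 0 < lower_slope.
Proof. by rewrite /lower_slope divr_gt0// mulr_gt0// exprn_gt0. Qed.

Lemma lower_const_ge0 N : 0 <= lower_const N.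
Proof.
have a0 := ltW alpha_gt0; apply: addr_ge0; last by rewrite mulr_ge0// invr_ge0.
by rewrite addr_ge0 ?spread_ge0// divr_ge0 ?sqr_ge0// mulr_ge0 ?sqr_ge0.
Qed.

Lemma upper_slope_ge0 N : 0 <= upper_slope N.
Proof.
have D0 := spread_ge0 B N; have B0 := bound_ge0.
by rewrite /upper_slope !addr_ge0// divr_ge0// mulr_ge0 ?sqr_ge0// ltW.
Qed.

Lemma upper_const_gt0 N : 0 < upper_const N.
Proof.
have D0 := spread_ge0 B N; have B0 := bound_ge0.
by rewrite /upper_const ltr_wpDl// addr_ge0// mulr_ge0.
Qed.

Section one_model.
Variables (M : model R) (z : 'rV[R]_(zdim M)) (N : nat).
Hypothesis zM : decisions M z.
Hypothesis N_gt0 : (0 < N)%N.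

Let L := loss M z.
Let mL : measurable_fun setT L. Proof. exact: loss_measurable. Qed.

Lemma estimatorE w : estimator alpha z fit N w =
  ((sample_risk alpha (fun i : 'I_N => L (sample M i w)))%:E +
   bias_correction alpha N (calibrate fit (scenarios z N w)))%E.
Proof. by rewrite /estimator entropic_risk_empirical. Qed.

Let x w := scenarios z N w.

Lemma estimator_ge w :
  ((smean (x w) + (lower_slope * ssdev (x w) ^+ 2 - lower_const N))%:E <=
   estimator alpha z fit N w)%E.
Proof.
rewrite estimatorE EFinD; apply: leeD.
  rewrite lee_fin (le_trans _ (sample_risk_ge_mean alpha_gt0 _ N_gt0))//.
  by rewrite smean_scenarios.
have Th := fitted_in_Theta (standardize (x w)).
have [sB mB] := Theta_bounded Th; have [we me se] := Theta_nondegenerate Th.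
exact: (bias_correction_ge alpha_gt0 sB mB eps_gt0 we me se _ (ssdev_ge0 (x w)) N_gt0).
Qed.

Lemma estimator_le w :
  (estimator alpha z fit N w <=
   (smean (x w) + (upper_slope N * ssdev (x w) ^+ 2 + upper_const N))%:E)%E.
Proof.
have -> : smean (x w) + (upper_slope N * ssdev (x w) ^+ 2 + upper_const N) =
    (smean (x w) + (N%:R * ssdev (x w) ^+ 2 + 1)) +
    ((B + alpha * B ^+ 2 / 2 + spread B N) * ssdev (x w) ^+ 2 + (B + 2 * spread B N)).
  by rewrite /upper_slope /upper_const; ring.
rewrite estimatorE EFinD; apply: leeD.
  rewrite lee_fin; apply: sample_risk_le => // i.
  by have := coord_le_smean N_gt0 (x w) i; rewrite {1}/x tnth_scenarios.
have Th := fitted_in_Theta (standardize (x w)).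
have [sB mB] := Theta_bounded Th; have [we me se] := Theta_nondegenerate Th.
exact: (bias_correction_le alpha_gt0 sB mB eps_gt0 we _ (ssdev_ge0 (x w)) N_gt0).
Qed.

Lemma measurable_estimator : measurable_fun setT (estimator alpha z fit N).
Proof.
rewrite (_ : estimator alpha z fit N = fun w =>
  ((sample_risk alpha (fun i : 'I_N => L (sample M i w)))%:E +
   bias_correction alpha N (calibrate fit (scenarios z N w)))%E); last first.
  by apply/funext => w; exact: estimatorE.
apply: emeasurable_funD.
  apply/measurable_EFinP; apply: measurable_funM => //.
  apply: measurableT_comp; first exact: measurable_ln.
  apply: measurable_funM => //; apply: measurable_sum => i.
  apply: measurableT_comp => //; apply: measurable_funM => //.
  exact: measurable_sampled_loss.
have we theta : Theta theta -> eps <= tnth (weights theta) j0.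
  by move=> /Theta_nondegenerate[].
have mb := measurable_bias_correction alpha fit_rule eps_gt0 we N_gt0.
have ms : measurable_fun setT (@scenarios R M z N) by exact: measurable_scenarios.
exact: (measurableT_comp mb ms).
Qed.

Hypothesis light : lighter_than_gaussian (law M) (loss M z).

Let mean_affine (k c : R) :
  (\int[Pr M]_w (smean (x w) + (k * ssdev (x w) ^+ 2 + c))%:E =
   (loss_mean z + (k * (loss_var z * (1 - N%:R^-1)) + c))%:E)%E.
Proof.
have L1s := L1_smean zM light N; have L1v := L1_ssdev_sqr zM light N_gt0.
have L1k : L1 (Pr M) (fun w => k * ssdev (x w) ^+ 2 + c).
  by apply: L1D; [exact: L1Z|exact: L1_cst].
rewrite EFin_mean; last exact: L1D.
rewrite meanD// meanD; [|exact: L1Z|exact: L1_cst].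
by rewrite meanZ// mean_cst mean_smean// mean_ssdev_sqr.
Qed.

Lemma mean_estimator_ge :
  ((loss_mean z + (lower_slope * (loss_var z * (1 - N%:R^-1)) - lower_const N))%:E
   <= mean_estimator alpha z fit N)%E.
Proof. by rewrite -mean_affine; apply: le_integral_any => w; exact: estimator_ge. Qed.

Lemma mean_estimator_le :
  (mean_estimator alpha z fit N <=
   (loss_mean z + (upper_slope N * (loss_var z * (1 - N%:R^-1)) + upper_const N))%:E)%E.
Proof. by rewrite -mean_affine; apply: le_integral_any => w; exact: estimator_le. Qed.

End one_model.

(** A sample of at most one scenario has no dispersion. *)
Lemma well_defined_gt1 (M : model R) (z : 'rV[R]_(zdim M)) N :
  well_defined z N -> (1 < N)%N.
Proof.
move=> wd; rewrite ltnNge; apply/negP => N1.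
have nil w : ssdev (scenarios z N w) = 0.
  case: N N1 {wd} => [|[|//]] _; apply/eqP; rewrite sqrtr_eq0.
    by rewrite big_ord0 mulr0.
  by rewrite big_ord1 /smean big_ord1 invr1 !mul1r subrr expr0n.
have [A [_ A0 sub]] : (Pr M).-negligible [set: Omega M].
  by apply: negligibleS wd => w _ /=; rewrite nil ltxx.
have AT : A = setT by apply/seteqP; split.
by move/eqP: A0; rewrite AT probability_setT onee_eq0.
Qed.

Section location_scale_family.
Context (dxi : measure_display) (Txi : measurableType dxi)
  (Pxi : probability Txi R) (xi : {RV Pxi >-> R}).
Hypothesis xi_mean : 'E_Pxi[xi] = 0%E.
Hypothesis xi_var : 'E_Pxi[fun t => xi t ^+ 2] = 1%E.

Let mxi : measurable_fun setT (xi : Txi -> R). Proof. by []. Qed.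

Let L1_xi_sqr : L1 Pxi (fun t => xi t ^+ 2).
Proof.
apply: (@ge0_L1 _ _ _ _ _ 1%E) => //.
- exact: measurable_funX.
- by move=> t; exact: sqr_ge0.
- by rewrite -xi_var unlock.
- exact: ltry.
Qed.

Let L1_xi : L1 Pxi xi. Proof. exact: L1_sqr L1_xi_sqr. Qed.

Let mean_xi : \int[Pxi]_t xi t = 0.
Proof. by rewrite /Rintegral; move: xi_mean; rewrite unlock => ->. Qed.

Let mean_xi_sqr : \int[Pxi]_t (xi t ^+ 2) = 1.
Proof. by rewrite /Rintegral; move: xi_var; rewrite unlock => ->. Qed.

(** Completing the square in [alpha * sigma * xi] against
    [xi ^ 2 / (4 * e)]. The last term depends on the law of xi only. *)
Lemma location_scale_risk_le (e : R) (M : model R) (z : 'rV[R]_(zdim M)) :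
  0 < e -> location_scale M xi -> light_tailed_losses M -> decisions M z ->
  0 < loss_var z ->
  alpha^-1 * ln (\int[law M]_t expR (alpha * loss M z t)) <=
    loss_mean z + e * alpha * loss_var z +
    alpha^-1 * `|ln (\int[Pxi]_t expR ((4 * e)^-1 * xi t ^+ 2))|.
Proof.
move=> e0 [A [A0 AL _]] light zM v0; have lz := light z zM.
have [[mu sigma] Ap sl] := AL z zM.
pose L := loss M z; have mL : measurable_fun setT L by exact: loss_measurable.
pose F := affine mu sigma \o xi.
have mF : measurable_fun setT F.
  by apply: measurableT_comp => //; exact: measurable_affine.
pose nu : probability R R := distribution (law M) (mfun_of mL).
have lawL C : measurable C -> law M (L @^-1` C) = nu C by [].
have lawF C : measurable C -> Pxi (F @^-1` C) = nu C.
  by move=> mC; exact/esym/sl.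
have mean_nu (f : R -> R) : L1 nu f -> \int[law M]_t f (L t) = \int[Pxi]_t f (F t).
  by move=> Lf; rewrite (mean_law mL lawL Lf) (mean_law mF lawF Lf).
have L1_nu (f : R -> R) : measurable_fun setT f -> (forall y, 0 <= f y) ->
    L1 (law M) (f \o L) -> L1 nu f.
  move=> mf f0 Lf; apply: (@ge0_L1 _ _ _ _ _ (\int[law M]_t f (L t))%:E) => //.
    rewrite -(ge0_integral_law mL lawL (f := fun y => (f y)%:E)).
    - by rewrite EFin_mean.
    - exact/measurable_EFinP.
    - by move=> y; rewrite lee_fin.
  exact: ltry.
have L1_nu_sqr : L1 nu (fun y => y ^+ 2).
  apply: L1_nu; [exact: exprn_measurable|by move=> y; exact: sqr_ge0|].
  exact: L1_loss_sqr.
have L1_nu_id : L1 nu id by apply: L1_sqr => //; exact: measurable_id.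
have muE : loss_mean z = mu.
  rewrite /loss_mean (mean_nu id)// /F /affine /=.
  rewrite meanD; [|exact: L1_cst|exact: L1Z].
  by rewrite mean_cst meanZ// mean_xi mulr0 addr0.
have varE : loss_var z = sigma ^+ 2.
  rewrite /loss_var muE (mean_nu (fun y => (y - mu) ^+ 2)).
    transitivity (\int[Pxi]_t (sigma ^+ 2 * xi t ^+ 2)).
      by apply: eq_Rintegral => t _; rewrite /F /affine /=; ring.
    by rewrite meanZ// mean_xi_sqr mulr1.
  by apply: L1_sqr_dev => //; exact: measurable_id.
have s0 : sigma != 0 by apply: contraTneq v0 => s0; rewrite varE s0 expr0n ltxx.
have a0 : alpha != 0 by rewrite gt_eqF.
set K := \int[Pxi]_t _.
(* the exponential moments of xi ^ 2 are inherited from the losses *)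
have LK : L1 Pxi (fun t => expR ((4 * e)^-1 * xi t ^+ 2)).
  pose g (y : R) := expR ((4 * e)^-1 * ((y - mu) / sigma) ^+ 2).
  have mg : measurable_fun setT g.
    apply: measurableT_comp => //; apply: measurable_funM => //.
    apply: measurable_funX; apply: measurable_funM => //.
    exact: measurable_funB.
  have -> : (fun t => expR ((4 * e)^-1 * xi t ^+ 2)) = g \o F.
    by apply/funext => t; rewrite /g /F /affine /= addrAC subrr add0r mulrAC divff// mul1r.
  apply: (L1_law mF lawF); apply: L1_nu => //; first by move=> y; exact: expR_ge0.
  pose k := (4 * e)^-1 / sigma ^+ 2 * 2.
  have k0 : 0 <= k by rewrite /k mulr_ge0// divr_ge0 ?sqr_ge0// invr_ge0 mulr_ge0// ltW.
  apply: (@L1_le _ _ _ (law M) _ (fun t => expR (k * mu ^+ 2) * expR (k * L t ^+ 2))).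
  - exact: measurableT_comp.
  - move=> t; rewrite ger0_norm ?expR_ge0// -expRD ler_expR.
    rewrite expr_div_n mulrA mulrAC -mulrDr /k -mulrA.
    rewrite mulrAC -!mulrA ler_wpM2l ?invr_ge0 ?mulr_ge0 ?(ltW e0)//.
    rewrite ler_wpM2l ?invr_ge0 ?sqr_ge0//.
    by have := sqr_ge0 (L t + mu); nra.
  - by apply: L1Z; exact: light_tail_L1.
have K1 : 1 <= K.
  rewrite -[leLHS](mean_cst Pxi); apply: le_mean => //; first exact: L1_cst.
  by move=> t; rewrite -[leLHS]expR0 ler_expR mulr_ge0 ?sqr_ge0// invr_ge0 mulr_ge0// ltW.
have K0 : 0 < K by exact: lt_le_trans K1.
have L1_nu_exp : L1 nu (fun y => expR (alpha * y)).
  apply: L1_nu; first exact: measurable_expM.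
    by move=> y; exact: expR_ge0.
  exact: L1_loss_expR.
have -> : \int[law M]_t expR (alpha * loss M z t) = \int[Pxi]_t expR (alpha * F t).
  exact: (mean_nu (fun y => expR (alpha * y))).
have le1 : \int[Pxi]_t expR (alpha * F t) <=
    expR (alpha * mu + e * alpha ^+ 2 * sigma ^+ 2) * K.
  rewrite -meanZ//; apply: le_mean.
  - exact: (L1_law mF lawF L1_nu_exp).
  - exact: L1Z.
  - move=> t; rewrite -expRD ler_expR /F /affine /=.
    rewrite -subr_ge0.
    have -> : alpha * mu + e * alpha ^+ 2 * sigma ^+ 2 + (4 * e)^-1 * xi t ^+ 2 -
        alpha * (mu + sigma * xi t) = (2 * e * alpha * sigma - xi t) ^+ 2 / (4 * e).
      by field; rewrite gt_eqF.
    by rewrite divr_ge0 ?sqr_ge0// mulr_ge0// ltW.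
have pos : 0 < \int[Pxi]_t expR (alpha * F t).
  rewrite -(mean_nu (fun y => expR (alpha * y)))//.
  have j := jensen_expR (L1_loss zM lz) (L1_loss_expR zM lz alpha).
  exact: lt_le_trans (expR_gt0 _) j.
rewrite ler_pdivrMl//.
apply: (@le_trans _ _ (ln (expR (alpha * mu + e * alpha ^+ 2 * sigma ^+ 2) * K))).
  by rewrite ler_ln ?posrE ?mulr_gt0 ?expR_gt0.
rewrite lnM ?posrE ?expR_gt0// expRK muE varE.
have -> : alpha * (mu + e * alpha * sigma ^+ 2 + alpha^-1 * `|ln K|) =
    alpha * mu + e * alpha ^+ 2 * sigma ^+ 2 + `|ln K| by field.
by rewrite lerD2l ler_norm.
Qed.

End location_scale_family.

End estimator_bounds.

(** * Consistency *)

Section consistency.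
Local Open Scope ring_scope.
Context (R : realType) (alpha : R) (J : nat) (Theta : set (gmm_param R J)).
Variable fit : forall N, N.-tuple R -> gmm_param R J.
Variables (B eps b : R) (j0 : 'I_J).
Hypothesis alpha_gt0 : 0 < alpha.
Hypothesis Theta_bounded : forall theta, Theta theta ->
  (forall j, tnth (sdevs theta) j <= B) /\ (forall j, `|tnth (means theta) j| <= B).
Hypothesis eps_gt0 : 0 < eps.
Hypothesis Theta_nondegenerate : forall theta, Theta theta ->
  [/\ eps <= tnth (weights theta) j0, b <= tnth (means theta) j0 &
      eps <= tnth (sdevs theta) j0].
Hypothesis fit_rule : fitting_rule Theta fit.
Variables (M : model R) (z : 'rV[R]_(zdim M)).
Hypothesis zM : decisions M z.
Hypothesis light : lighter_than_gaussian (law M) (loss M z).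

Let L := loss M z.
Let mL : measurable_fun setT L. Proof. exact: loss_measurable. Qed.
Let p := \int[law M]_t expR (alpha * L t).
Let vp := \int[law M]_t ((expR (alpha * L t) - p) ^+ 2).
Let h (y : R) := expR (alpha * y).
Let mh : measurable_fun setT h. Proof. exact: measurable_expM. Qed.
Let Y (i : nat) w := L (sample M i w).
Let avg N w := N%:R^-1 * \sum_(i < N) h (Y i w).

Let p_gt0 : 0 < p.
Proof.
have LE := L1_loss_expR zM light alpha.
exact: lt_le_trans (expR_gt0 _) (jensen_expR (L1_loss zM light) LE).
Qed.

Let L1_h2 : L1 (law M) ((fun y => h y ^+ 2) \o L).
Proof.
have -> : (fun y => h y ^+ 2) \o L = fun t => expR (2 * alpha * L t).
  by apply/funext => t; rewrite /h /= expr2 -expRD; congr expR; ring.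
exact: L1_loss_expR.
Qed.

Let L1_hvar : L1 (law M) ((fun y => (h y - p) ^+ 2) \o L).
Proof. by apply: L1_sqr_dev L1_h2; exact: measurableT_comp. Qed.

Let prob_avg_far N e : (0 < N)%N -> 0 < e ->
  (Pr M [set w | (e <= `|avg N w - p|)%R] <= (vp / (N%:R * e ^+ 2))%:E)%E.
Proof.
move=> N0 e0.
apply: (@weak_law _ _ _ (Pr M) N (fun i => h \o Y i) p vp N0) => //.
- by move=> i; apply: measurableT_comp => //; exact: measurable_sampled_loss.
- by move=> i; exact: (L1_sampled i (f := fun y => h y ^+ 2) L1_h2).
- by move=> i; exact: (mean_sampled i (f := h) (L1_loss_expR zM light alpha)).
- by move=> i; exact: (mean_sampled i (f := fun y => (h y - p) ^+ 2) L1_hvar).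
- move=> i j ij; apply: (pair_independent_comp mh).
  exact: sampled_independent.
Qed.

Let measurable_far N e : measurable [set w | e <= `|avg N w - p|].
Proof.
apply: measurable_superlevel; apply: measurableT_comp => //.
apply: measurable_funB => //; apply: measurable_funM => //.
apply: measurable_sum => i.
by apply: measurableT_comp => //; exact: measurable_sampled_loss.
Qed.

Let ssdev2 N w := ssdev (scenarios z N w) ^+ 2.

Let prob_dispersed N t : (0 < N)%N -> 0 < t ->
  (Pr M [set w | (t <= ssdev2 N w)%R] <= (loss_var z / t)%:E)%E.
Proof.
move=> N0 t0; apply: markov_ge0 => //.
- exact: L1_ssdev_sqr.
- by move=> w; exact: sqr_ge0.
- by rewrite mean_ssdev_sqr// ler_piMr ?loss_var_ge0// gerBl invr_ge0.
Qed.

Let measurable_dispersed N t : (0 < N)%N -> measurable [set w | t <= ssdev2 N w].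
Proof.
by move=> N0; apply: measurable_superlevel (L1_measurable (L1_ssdev_sqr zM light N0)).
Qed.

Let V2 S := expR (2 * alpha * S * B + (2 * alpha * S * B) ^+ 2 / 2).
Let p1 S := eps * expR (- (alpha * S * `|b|)).

(** Off two events of small probability, the sample risk and the correction are
    each within 2 * e / alpha of their limits. *)
Let error_le N S e w : (0 < N)%N -> 0 < e -> e <= 2^-1 -> 0 <= S ->
  V2 S / (N%:R * (e * p1 S) ^+ 2) < 2^-1 ->
  ~ (e * p <= `|avg N w - p|) -> ~ (S ^+ 2 <= ssdev2 N w) ->
  (`|estimator alpha z fit N w - true_risk alpha z| <= (4 * e / alpha)%:E)%E.
Proof.
move=> N0 e0 e2 S0 Nbig /negP near /negP small.
have sS : ssdev (scenarios z N w) <= S.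
  by rewrite -ler_sqr ?nnegrE ?ssdev_ge0// ltW// ltNge.
have Th := fitted_in_Theta fit_rule (standardize (scenarios z N w)).
have [sB mB] := Theta_bounded Th; have [we me se] := Theta_nondegenerate Th.
have bias := bias_correction_small alpha_gt0 sB mB eps_gt0 we me se
  (smean (scenarios z N w)) (ssdev_ge0 _) N0 e0 e2 sS Nbig.
have [a0 lnp] : 0 < avg N w /\ `|ln p - ln (avg N w)| <= 2 * e.
  by apply: ln_close => //; rewrite ltNge.
rewrite estimatorE// true_riskE// -/L -/p.
rewrite /sample_risk -/(avg N w) addeAC -EFinB.
apply: le_trans (lee_abs_add _ _) _.
have -> : 4 * e / alpha = 2 * e / alpha + 2 * e / alpha by field; rewrite gt_eqF.
rewrite [leRHS]EFinD; apply: leeD => //.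
rewrite abse_EFin lee_fin -mulrBr normrM gtr0_norm ?invr_gt0// mulrC.
by rewrite ler_wpM2r ?invr_ge0 ?(ltW alpha_gt0)// distrC.
Qed.

Lemma estimator_consistent :
  cvg_in_probability (Pr M) (estimator alpha z fit) (true_risk alpha z).
Proof.
move=> r r0.
pose bad N := [set w | (r%:E <= `|estimator alpha z fit N w - true_risk alpha z|)%E].
have mbad N : (0 < N)%N -> measurable (bad N).
  move=> N0; rewrite -[X in measurable X]setTI.
  apply: emeasurable_fun_c_infty => //; apply: measurableT_comp => //.
  rewrite true_riskE//; apply: emeasurable_funB => //.
  exact: (measurable_estimator alpha eps_gt0 Theta_nondegenerate fit_rule zM N0).
pose e := Num.min 2^-1 (alpha * r / 8).
have e0 : 0 < e by rewrite lt_min invr_gt0 ltr0n/= divr_gt0// mulr_gt0.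
have e2 : e <= 2^-1 by rewrite ge_min lexx.
have er : 4 * e / alpha < r.
  have : e <= alpha * r / 8 by rewrite ge_min lexx orbT.
  by rewrite ltr_pdivrMr// mulrC; have := mulr_gt0 alpha_gt0 r0; lra.
suff lim t : 0 < t -> \forall N \near \oo, (Pr M (bad N) <= t%:E)%E.
  apply/fine_cvgP; split.
    by near=> N; apply: fin_num_measure; apply: mbad; near: N; exact: nbhs_infty_gt.
  apply/cvgrPdist_le => t t0; near=> N.
  have fN : Pr M (bad N) \is a fin_num.
    by apply: fin_num_measure; apply: mbad; near: N; exact: nbhs_infty_gt.
  rewrite sub0r normrN ger0_norm ?fine_ge0// -lee_fin fineK//.
  by near: N; exact: lim.
move=> t0.
(* Markov's inequality leaves at most t / 2 to the standard deviations above S *)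
pose S := Num.sqrt (2 * loss_var z / t + 1).
have v0 : 0 <= loss_var z by exact: loss_var_ge0.
have S2 : S ^+ 2 = 2 * loss_var z / t + 1.
  by rewrite sqr_sqrtr// addr_ge0// divr_ge0 ?mulr_ge0// ltW.
have S2_gt0 : 0 < S ^+ 2.
  by rewrite S2 ltr_wpDl// divr_ge0 ?mulr_ge0// ltW.
have ep0 : 0 < (e * p) ^+ 2 by rewrite exprn_gt0// mulr_gt0.
have ep1 : 0 < (e * p1 S) ^+ 2.
  by rewrite exprn_gt0// mulr_gt0// mulr_gt0// expR_gt0.
have vp0 : 0 <= vp by apply: Rintegral_ge0 => w _; exact: sqr_ge0.
near=> N.
have N0 : (0 < N)%N by near: N; exact: nbhs_infty_gt.
have NR0 : 0 < N%:R :> R by rewrite ltr0n.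
have Nbias : V2 S / (N%:R * (e * p1 S) ^+ 2) < 2^-1.
  have : 2 * V2 S / (e * p1 S) ^+ 2 < N%:R.
    by near: N; exact: nbhs_infty_gtr.
  rewrite ltr_pdivrMr// => hN.
  rewrite ltr_pdivrMr; last exact: mulr_gt0.
  by move: (V2 S) (N%:R * _) hN => u c hN; lra.
have Navg : vp / (N%:R * (e * p) ^+ 2) <= t / 2.
  have : 2 * vp / (t * (e * p) ^+ 2) < N%:R.
    by near: N; exact: nbhs_infty_gtr.
  rewrite ltr_pdivrMr; last exact: mulr_gt0.
  rewrite mulrCA => hN; rewrite ler_pdivrMr; last exact: mulr_gt0.
  rewrite mulrAC.
  by move: (t * _) hN => u hN; lra.
pose far := [set w | e * p <= `|avg N w - p|].
pose dispersed := [set w | S ^+ 2 <= ssdev2 N w].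
have sub : bad N `<=` far `|` dispersed.
  move=> w badw; apply: contrapT => /not_orP[nf nd]; move: badw; rewrite /bad /=.
  apply/negP; rewrite -ltNge.
  apply: le_lt_trans (error_le N0 e0 e2 (sqrtr_ge0 _) Nbias nf nd) _.
  by rewrite lte_fin.
have mfar : measurable far by exact: measurable_far.
have mdis : measurable dispersed by exact: measurable_dispersed.
apply: le_trans (le_measure _ _ _ sub) _; rewrite ?inE; [exact: mbad|exact: measurableU|].
apply: le_trans (measureU2 _ mfar mdis) _.
have -> : t = t / 2 + t / 2 by field.
rewrite EFinD; apply: leeD.
  apply: le_trans (prob_avg_far N0 (mulr_gt0 e0 p_gt0)) _.
  by rewrite lee_fin.
apply: le_trans (prob_dispersed N0 S2_gt0) _.
rewrite lee_fin ler_pdivrMr// S2.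
have -> : t / 2 * (2 * loss_var z / t + 1) = loss_var z + t / 2.
  by field; rewrite gt_eqF.
by rewrite lerDl divr_ge0// ltW.
Unshelve. all: by end_near.
Qed.

End consistency.

(** * The bias has the order of the variance *)

Section order_of_the_bias.
Local Open Scope ring_scope.
Context (R : realType) (alpha : R) (J : nat) (Theta : set (gmm_param R J)).
Variable fit : forall N, N.-tuple R -> gmm_param R J.
Variables (B eps b : R) (j0 : 'I_J).
Hypothesis alpha_gt0 : 0 < alpha.
Hypothesis Theta_bounded : forall theta, Theta theta ->
  (forall j, tnth (sdevs theta) j <= B) /\ (forall j, `|tnth (means theta) j| <= B).
Hypothesis eps_gt0 : 0 < eps.
Hypothesis Theta_nondegenerate : forall theta, Theta theta ->
  [/\ eps <= tnth (weights theta) j0, b <= tnth (means theta) j0 &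
      eps <= tnth (sdevs theta) j0].
Hypothesis fit_rule : fitting_rule Theta fit.
Context (dxi : measure_display) (Txi : measurableType dxi)
  (Pxi : probability Txi R) (xi : {RV Pxi >-> R}).
Hypothesis xi_mean : 'E_Pxi[xi] = 0%E.
Hypothesis xi_var : 'E_Pxi[fun t => xi t ^+ 2] = 1%E.

Lemma square_dominates (c D : R) : 0 < c -> 0 <= D -> exists2 sbar : R, 1 <= sbar &
  forall v, sbar <= Num.sqrt v -> 1 <= v /\ D <= c * v.
Proof.
move=> c0 D0; have Dc : 0 <= D / c by rewrite divr_ge0// ltW.
exists (1 + D / c); first by rewrite lerDl.
move=> v sv.
have v0 : 0 <= v.
  rewrite leNgt; apply/negP => v0; move: sv; rewrite ler0_sqrtr; last exact: ltW.
  by rewrite leNgt ltr_pwDl.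
have : (1 + D / c) ^+ 2 <= v.
  by rewrite -[leRHS]sqr_sqrtr// ler_sqr ?nnegrE ?sqrtr_ge0 ?addr_ge0.
move=> h; have h1 : 1 + D / c <= v by have := sqr_ge0 (D / c); nra.
split; first by rewrite (le_trans _ h1)// lerDl.
by rewrite -ler_pdivrMl// mulrC (le_trans _ h1)// lerDr.
Qed.

(** The Gaussian component contributes a multiple of the variance to the
    correction, while the risk of the light-tailed losses is only o(variance):
    e is chosen so that the latter is at most half of the former. *)
Lemma bias_ge_variance (N : nat) : exists c sbar : R, [/\ 0 < c, 1 <= sbar &
  forall M : model R, location_scale M xi -> light_tailed_losses M ->
  forall z, decisions M z -> well_defined z N -> (sbar%:E <= loss_sdev z)%E ->
    ((c * loss_var z)%:E <= mean_estimator alpha z fit N - true_risk alpha z)%E].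
Proof.
have [N2|N1] := ltnP 1 N; last first.
  exists 1, 1; split => // M _ _ z _ /well_defined_gt1.
  by rewrite ltnNge N1.
have N0 : (0 < N)%N by exact: ltnW.
pose k : R := 1 - N%:R^-1.
have k0 : 0 < k by rewrite subr_gt0 invf_lt1 ?ltr1n ?ltr0n.
pose s1 := lower_slope alpha eps * k.
have s1_gt0 : 0 < s1 by rewrite mulr_gt0// lower_slope_gt0.
pose e := s1 / (2 * alpha).
have e0 : 0 < e by rewrite divr_gt0// mulr_gt0.
pose lnK := alpha^-1 * `|ln (\int[Pxi]_t expR ((4 * e)^-1 * xi t ^+ 2))|.
have lnK0 : 0 <= lnK by rewrite mulr_ge0// invr_ge0 ltW.
pose C1 := lower_const alpha B eps b N.
have C10 : 0 <= C1 by exact: lower_const_ge0.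
have c0 : 0 < s1 / 4 by rewrite divr_gt0.
have [sbar sbar1 dom] := square_dominates c0 (addr_ge0 C10 lnK0).
exists (s1 / 4), sbar; split => // M ls lt z zM wd.
have lz := lt z zM.
rewrite loss_sdevE// lee_fin => /dom[v1 vD].
have v0 : 0 < loss_var z by exact: lt_le_trans v1.
have rle := location_scale_risk_le alpha_gt0 xi_mean xi_var e0 ls lt zM v0.
have mge := mean_estimator_ge alpha_gt0 Theta_bounded eps_gt0 Theta_nondegenerate
  fit_rule zM N0 lz.
rewrite true_riskE// leeBrDr// -EFinD; apply: le_trans mge; rewrite lee_fin.
have ea : e * alpha = s1 / 2 by rewrite /e; field; rewrite gt_eqF.
move: rle; rewrite ea -/lnK -/C1 => rle.
have -> : lower_slope alpha eps * (loss_var z * (1 - N%:R^-1)) = s1 * loss_var z.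
  by rewrite /s1 /k; ring.
lra.
Qed.

(** The bias is nonnegative by the lower bound, so that its absolute value calls
    for an upper bound only. *)
Lemma bias_le_variance (N : nat) : exists c sbar : R, [/\ 0 < c, 0 < sbar &
  forall M : model R, location_scale M xi -> light_tailed_losses M ->
  forall z, decisions M z -> well_defined z N -> (sbar%:E <= loss_sdev z)%E ->
    (`|true_risk alpha z - mean_estimator alpha z fit N| <= (c * loss_var z)%:E)%E].
Proof.
have [c [sbar [c0 sbar1 low]]] := bias_ge_variance N.
have B0 := bound_ge0 j0 Theta_bounded fit_rule.
exists (upper_slope alpha B N + upper_const B N), sbar; split.
- apply: ltr_wpDl.
    exact: (upper_slope_ge0 j0 alpha_gt0 Theta_bounded fit_rule N).
  exact: (upper_const_gt0 j0 Theta_bounded fit_rule N).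
- exact: lt_le_trans sbar1.
move=> M ls lt z zM wd sv; have lz := lt z zM.
have N0 : (0 < N)%N by exact: ltnW (well_defined_gt1 wd).
have v1 : 1 <= loss_var z.
  move: sv; rewrite loss_sdevE// lee_fin => /(le_trans sbar1).
  by move=> s1; rewrite -[leRHS]sqr_sqrtr ?loss_var_ge0// expr_ge1// ?sqrtr_ge0.
have := low M ls lt z zM wd sv.
have := mean_estimator_le alpha_gt0 Theta_bounded eps_gt0 Theta_nondegenerate
  fit_rule zM N0 lz.
have := true_risk_ge_mean zM lz alpha_gt0.
rewrite true_riskE//; move: (alpha^-1 * _) => rho mrho.
have h1 : loss_var z * (1 - N%:R^-1) <= loss_var z.
  by rewrite ler_piMr ?gerBl ?invr_ge0// (le_trans ler01).
have h2 := upper_slope_ge0 j0 alpha_gt0 Theta_bounded fit_rule N.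
have h3 := upper_const_gt0 j0 Theta_bounded fit_rule N.
case: (mean_estimator alpha z fit N) => [y||]//=.
rewrite !lee_fin => yle yge.
have cv : 0 <= c * loss_var z by rewrite mulr_ge0 ?(ltW c0)// (le_trans ler01).
rewrite distrC ger0_norm ?(le_trans cv)//.
have h4 := ler_wpM2l h2 h1.
have h5 : upper_const B N <= upper_const B N * loss_var z by rewrite ler_peMr// ltW.
by rewrite mulrDl; lra.
Qed.

End order_of_the_bias.

Theorem theorem11 (R : realType) (alpha : R) (alpha_gt0 : (0 < alpha)%R)
    (* the fixed standardized random variable of the location-scale family *)
    (dxi : measure_display) (Txi : measurableType dxi)
    (Pxi : probability Txi R) (xi : {RV Pxi >-> R})
    (xi_mean : 'E_Pxi[xi] = 0)
    (xi_var : 'E_Pxi[fun t => (xi t ^+ 2)%R] = 1)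
    (* the class of Gaussian mixtures *)
    (J : nat) (Theta : set (gmm_param R J))
    (Theta_bounded : exists2 B : R, (0 < B)%R &
       forall theta, Theta theta ->
         (forall j, (tnth (sdevs theta) j <= B)%R) /\
         (forall j, (`|tnth (means theta) j| <= B)%R))
    (Theta_nondegenerate : exists (eps B' : R) (j : 'I_J), (0 < eps)%R /\
       forall theta, Theta theta ->
         [/\ (eps <= tnth (weights theta) j)%R,
             (B' <= tnth (means theta) j)%R &
             (eps <= tnth (sdevs theta) j)%R])
    (* the fitting rule of the calibration algorithm *)
    (fit : forall N, N.-tuple R -> gmm_param R J)
    (fit_rule : fitting_rule Theta fit) :
  [/\ (* asymptotic consistency, for a fixed decision *)
      forall M : model R, location_scale M xi -> light_tailed_losses M ->
      forall z, decisions M z -> (forall N, (2 <= N)%N -> well_defined z N) ->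
        cvg_in_probability (Pr M) (estimator alpha z fit) (true_risk alpha z),
      (* bias bounded below by a multiple of the variance *)
      forall N : nat, exists c sbar : R, [/\ (0 < c)%R, (0 < sbar)%R &
        forall M : model R, location_scale M xi -> light_tailed_losses M ->
        forall z, decisions M z -> well_defined z N ->
          sbar%:E <= loss_sdev z ->
          c%:E * loss_variance z <=
            mean_estimator alpha z fit N - true_risk alpha z] &
      (* absolute bias bounded above by a multiple of the variance *)
      forall N : nat, exists c sbar : R, [/\ (0 < c)%R, (0 < sbar)%R &
        forall M : model R, location_scale M xi -> light_tailed_losses M ->
        forall z, decisions M z -> well_defined z N ->
          sbar%:E <= loss_sdev z ->
          `|true_risk alpha z - mean_estimator alpha z fit N| <=
            c%:E * loss_variance z]].
Proof.
have [B B0 Tb] := Theta_bounded; have [eps [b [j0 [eps0 Tn]]]] := Theta_nondegenerate.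
split.
- move=> M ls lt z zM _.
  exact: (estimator_consistent alpha_gt0 Tb eps0 Tn fit_rule zM (lt z zM)).
- move=> N.
  have [c [sbar [c0 sbar1 low]]] :=
    bias_ge_variance alpha_gt0 Tb eps0 Tn fit_rule xi_mean xi_var N.
  exists c, sbar; split => //; first exact: lt_le_trans sbar1.
  move=> M ls lt z zM wd sv; rewrite loss_varianceE//; last exact: lt.
  exact: low.
- move=> N.
  have [c [sbar [c0 sbar0 up]]] :=
    bias_le_variance alpha_gt0 Tb eps0 Tn fit_rule xi_mean xi_var N.
  exists c, sbar; split => //.
  move=> M ls lt z zM wd sv; rewrite loss_varianceE//; last exact: lt.
  exact: up.
Qed.
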